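(* There exist absolute constants $\alpha_0>0$ and $\beta_0>0$ such that the following holds in the binary classification setting described in the context (with margin $h$, the same subsample $\mathcal{L}_1$ being used to grow and to prune the trees). Consider a penalty function of the form: for all $M\in\mathcal{P}(\Lambda)$ and all $T\preceq T_{max}^{(M)}$, $$pen(M,T)=\alpha\left[1+(|M|+1)\left(1+\log\left(\frac{n_1}{|M|+1}\right)\right)\right]\frac{|T|}{n_1h}+\beta\frac{|M|}{n_1h}\left(1+\log\left(\frac{p}{|M|}\right)\right).$$ If $\alpha>\alpha_0$ and $\beta>\beta_0$, then there exist three positive constants $C_1>2$, $C_2$, $\Sigma$, which depend only on $\alpha$ and $\beta$, such that for every $\xi>0$, with probability $\ge 1-e^{-\xi}\Sigma^2$, $$l_1(s,\tilde s)\le C_1\inf_{(M,T)}\big\{l_1(s,S_{M,T})+pen(M,T)\big\}+\frac{C_2}{n_1h}(1+\xi),$$ where $l_1(s,S_{M,T})=\inf_{u\in S_{M,T}}l_1(s,u)$ and the infimum is over all $M\in\mathcal{P}(\Lambda)$ and $T\preceq T_{max}^{(M)}$.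
   Context: Setting. $(X,Y)$ is a random pair with $X=(X^1,\dots,X^p)\in\mathbb{R}^p$ and $Y\in\{0,1\}$; $\mu$ is the law of $X$; $\eta(x)=\mathbb{E}[Y\mid X=x]$; the Bayes classifier is $s(x)=\mathbf{1}_{\eta(x)\ge1/2}$. Margin condition: there is $h>0$ with $|2\eta(x)-1|\ge h$ for all $x\in\mathbb{R}^p$. Samples (case (M2)). The training sample of independent copies of $(X,Y)$ is split into two independent subsamples $\mathcal{L}_1$ (size $n_1$) and $\mathcal{L}_3$ (size $n_3$); $\mathcal{L}_1$ is used both for growing the maximal trees and for pruning/selection. Loss. The expected loss conditional on $\{X_i,\ (X_i,Y_i)\in\mathcal{L}_1\}$ is, for $u:\mathbb{R}^p\to\{0,1\}$, $$l_1(s,u)=\mathbb{P}\big(u(X)\ne Y\mid\{X_i,(X_i,Y_i)\in\mathcal{L}_1\}\big)-\mathbb{P}\big(s(X)\ne Y\mid\{X_i,(X_i,Y_i)\in\mathcal{L}_1\}\big),$$ and $l_1(s,\tilde s)$ is the functional $l_1(s,\cdot)$ evaluated at the data-dependent $\tilde s$. Models. $\Lambda=\{X^1,\dots,X^p\}$ is the set of explanatory variables and $\mathcal{P}(\Lambda)$ the collection of its (nonempty) subsets $M$, $|M|$ being the cardinality. For each $M$, $T_{max}^{(M)}$ is the maximal binary tree built by the CART growing procedure from $\mathcal{L}_1$, using only admissible splits (questions $X^j\le c$) on variables $X^j\in M$: starting from the root $\mathbb{R}^p$, nodes are recursively split in two by the admissible split maximizing the decrease of an impurity function (e.g. the Gini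 index), until each terminal node contains one observation or observations with the same response. $T\preceq T_{max}^{(M)}$ means that $T$ is a pruned subtree (same root, obtained by cutting branches); $|T|$ is its number of leaves and $\tilde T$ is the partition of $\mathbb{R}^p$ given by its leaves. $S_{M,T}$ is the set of $\{0,1\}$-valued functions constant on each element of $\tilde T$. $\gamma_{n_1}(u)=\frac1{n_1}\sum_{(X_i,Y_i)\in\mathcal{L}_1}(Y_i-u(X_i))^2$, and $\hat s_{M,T}$ is a minimizer of $\gamma_{n_1}$ over $S_{M,T}$. The selected model $\widehat{(M,T)}$ minimizes $\gamma_{n_1}(\hat s_{M,T})+pen(M,T)$ over all $M\in\mathcal{P}(\Lambda)$, $T\preceq T_{max}^{(M)}$, and $\tilde s=\hat s_{\widehat{(M,T)}}$.
   Formalization: The formal theorem adds the assumption 1 + log(n_1/(|M|+1)) ≥ 0 for every nonempty M (i.e. p+1 ≤ e n_1); without it pen can be very negative (n_1=1, h=1, p→∞), making the right-hand side negative and the stated claim false. *)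

(* Defs.v *)
From HB Require Import structures.
From mathcomp Require Import all_boot all_order all_algebra.
From mathcomp Require Import all_classical all_reals all_analysis.
From mathcomp Require Import lra.

Set Implicit Arguments.
Unset Strict Implicit.
Unset Printing Implicit Defensive.

Import Order.TTheory GRing.Theory Num.Theory.
Import numFieldNormedType.Exports.

Local Open Scope classical_set_scope.
Local Open Scope ring_scope.

(* R^p is [p.-tuple R]: its library sigma-algebra is the one generated by the
   coordinates, i.e. the Borel one. A label in {0,1} is a [bool], a
   classifier is a function [p.-tuple R -> bool], and a subset of the
   variables X^1, ..., X^p is a set M : {set 'I_p} of indices. *)
Definition observation (R : realType) (p : nat) : Type := (p.-tuple R * bool)%type.
Definition sample (R : realType) (p n : nat) : Type := n.-tuple (observation R p).

Section trees.
Context {R : realType} {p : nat}.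
Implicit Types (C : set (p.-tuple R)) (M : {set 'I_p}).

(* [Node j c l r] asks "X^j <= c ?": [l] is the branch for yes, [r] for no. *)
Inductive tree : Type :=
| Leaf
| Node (j : 'I_p) (c : R) (l r : tree).

Fixpoint leaves (T : tree) : nat :=
  match T with Leaf => 1%N | Node _ _ l r => (leaves l + leaves r)%N end.

Fixpoint pruned (T T' : tree) : Prop :=
  match T, T' with
  | Leaf, _ => True
  | Node j c l r, Node j' c' l' r' =>
      [/\ j = j', c = c', pruned l l' & pruned r r']
  | Node _ _ _ _, Leaf => False
  end.

Fixpoint leaf_cells (T : tree) (C : set (p.-tuple R)) : set (set (p.-tuple R)) :=
  match T with
  | Leaf => [set C]
  | Node j c l r =>
      leaf_cells l (C `&` [set x | tnth x j <= c]) `|`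
      leaf_cells r (C `&` [set x | c < tnth x j])
  end.

Definition tree_partition (T : tree) : set (set (p.-tuple R)) :=
  leaf_cells T setT.

(* S_{M,T}; the set M intervenes only through T. *)
Definition model (T : tree) : set (p.-tuple R -> bool) :=
  [set u | forall C, tree_partition T C ->
           forall x y, C x -> C y -> u x = u y].

(* Impurity function of the proportion q of 1's in a node, in the sense of
   Breiman, Friedman, Olshen and Stone for two classes: symmetric, maximal
   only at the uniform distribution, minimal only at pure nodes. *)
Definition is_impurity (phi : R -> R) : Prop :=
  [/\ forall q, 0 <= q <= 1 -> phi (1 - q) = phi q,
      forall q, 0 <= q <= 1 -> q != 2^-1 -> phi q < phi 2^-1 &
      forall q, 0 < q < 1 -> phi 0 < phi q].

Lemma gini_is_impurity : is_impurity (fun q => 2 * q * (1 - q)).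
Proof.
split=> [q _|q q01 q2|q /andP[q0 q1]]; first by lra.
- have : 0 < (q - 2^-1) ^+ 2 by rewrite exprn_even_gt0//= subr_eq0.
  rewrite expr2; nra.
- by rewrite mulr0 mul0r !mulr_gt0// subr_gt0.
Qed.

Section growing.
Context {n : nat}.
Variables (phi : R -> R) (L : sample R p n).

Definition obs (i : 'I_n) : p.-tuple R := (tnth L i).1.
Definition label (i : 'I_n) : bool := (tnth L i).2.

(* A node of a tree is represented by the set A of the indices of the
   observations of L it contains. *)
Implicit Types A : {set 'I_n}.

Definition yes A (j : 'I_p) (c : R) : {set 'I_n} :=
  [set i in A | tnth (obs i) j <= c]%SET.
Definition no A (j : 'I_p) (c : R) : {set 'I_n} :=
  [set i in A | c < tnth (obs i) j]%SET.

Definition node_impurity A : R :=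
  phi (#|[set i in A | label i]%SET|%:R / #|A|%:R).

Definition impurity_decrease A (j : 'I_p) (c : R) : R :=
  node_impurity A
  - #|yes A j c|%:R / #|A|%:R * node_impurity (yes A j c)
  - #|no A j c|%:R / #|A|%:R * node_impurity (no A j c).

Definition admissible M A (j : 'I_p) (c : R) : Prop :=
  [/\ j \in M, yes A j c != finset.set0 & no A j c != finset.set0].

Definition best_split M A (j : 'I_p) (c : R) : Prop :=
  admissible M A j c /\
  forall j' c', admissible M A j' c' ->
    impurity_decrease A j' c' <= impurity_decrease A j c.

(* All responses agree (in particular when there is only one observation), or
   the observations cannot be separated by the variables in M, which may happen
   when some of them share their M-coordinates. *)
Definition terminal M A : Prop :=
  {in A &, forall i i', label i = label i'} \/
  ~ (exists j c, admissible M A j c).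

Fixpoint grown M A (T : tree) : Prop :=
  match T with
  | Leaf => terminal M A
  | Node j c l r =>
      [/\ ~ terminal M A, best_split M A j c,
          grown M (yes A j c) l & grown M (no A j c) r]
  end.

Definition maximal_tree M (T : tree) : Prop := grown M (finset.setT : {set 'I_n}) T.

Definition empirical_risk (u : p.-tuple R -> bool) : R :=
  n%:R^-1 * \sum_(i < n) ((label i)%:R - (u (obs i))%:R) ^+ 2.

Definition empirical_minimizer (T : tree) (u : p.-tuple R -> bool) : Prop :=
  model T u /\ forall v, model T v -> empirical_risk u <= empirical_risk v.

End growing.

Definition pen (alpha beta h : R) (n : nat) M (T : tree) : R :=
  alpha * (1 + #|M|.+1%:R * (1 + ln (n%:R / #|M|.+1%:R)))
    * ((leaves T)%:R / (n%:R * h))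
  + beta * (#|M|%:R / (n%:R * h)) * (1 + ln (p%:R / #|M|%:R)).

(* The pairs (M, T) with M nonempty and T a pruned subtree of the maximal
   tree Tmax M. *)
Definition candidate (Tmax : {set 'I_p} -> tree) (m : {set 'I_p} * tree) : Prop :=
  m.1 != finset.set0 /\ pruned m.2 (Tmax m.1).

Definition selected n (L : sample R p n) (penalty : {set 'I_p} -> tree -> R)
    (Tmax : {set 'I_p} -> tree)
    (shat : {set 'I_p} -> tree -> p.-tuple R -> bool)
    (m : {set 'I_p} * tree) : Prop :=
  candidate Tmax m /\
  forall m', candidate Tmax m' ->
    empirical_risk L (shat m.1 m.2) + penalty m.1 m.2 <=
    empirical_risk L (shat m'.1 m'.2) + penalty m'.1 m'.2.

Definition bayes (eta : p.-tuple R -> R) (x : p.-tuple R) : bool := 2^-1 <= eta x.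

(* Excess misclassification probability of u when (X, Y) has law Q. *)
Definition excess_loss (Q : set (observation R p) -> \bar R)
    (s u : p.-tuple R -> bool) : R :=
  fine (Q [set z | u z.1 != z.2]) - fine (Q [set z | s z.1 != z.2]).

Definition model_loss (Q : set (observation R p) -> \bar R)
    (s : p.-tuple R -> bool) (T : tree) : R :=
  inf [set excess_loss Q s u | u in model T].

End trees.
Arguments tree : clear implicits.

Section random.
Context {R : realType} {d : measure_display} {Omega : measurableType d}.
Variable P : probability Omega R.

Definition mutually_independent (I : finType) d' (E : measurableType d')
    (Z : I -> Omega -> E) : Prop :=
  forall (J : {set I}) (B : I -> set E), (forall i, measurable (B i)) ->
    P [set w | forall i, i \in J -> B i (Z i w)] =
    (\prod_(i in J) P (Z i @^-1` B i))%E.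

Definition same_law d' (E : measurableType d') (Z Z' : Omega -> E) : Prop :=
  forall B, measurable B -> P (Z @^-1` B) = P (Z' @^-1` B).

(* Z_1, ..., Z_n are independent copies of Z, independent of Z itself. *)
Definition independent_copies n d' (E : measurableType d')
    (Z : Omega -> E) (Zs : 'I_n -> Omega -> E) : Prop :=
  mutually_independent (fun o : option 'I_n => oapp Zs Z o) /\
  forall i, same_law (Zs i) Z.

(* eta is a version of x |-> E[Y | X = x]. *)
Definition regression_function p (X : {RV P >-> p.-tuple R}) (Y : {RV P >-> bool})
    (eta : p.-tuple R -> R) : Prop :=
  (distribution P X).-integrable setT (EFin \o eta) /\
  forall A, measurable A ->
    (\int[P]_(w in X @^-1` A) ((Y w)%:R)%:E =
     \int[distribution P X]_(x in A) (eta x)%:E)%E.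

(* kappa is a version of the conditional law of V given U. A kernel is needed,
   rather than one conditional probability per event, because it is evaluated
   at classifiers that depend on the sample. *)
Definition conditional_law d1 d2 (E1 : measurableType d1) (E2 : measurableType d2)
    (V : Omega -> E2) (U : Omega -> E1) (kappa : R.-pker E1 ~> E2) : Prop :=
  forall A B, measurable A -> measurable B ->
    P ((U @^-1` A) `&` (V @^-1` B)) = (\int[P]_(w in U @^-1` A) kappa (U w) B)%E.

End random.

(* The first n1 of the n1 + n3 observations form the subsample used for
   growing and pruning; the remaining n3 form the other subsample. *)
Definition subsample1 (R : realType) (Omega : Type) p n1 n3
    (D : 'I_(n1 + n3) -> Omega -> observation R p) (w : Omega) : sample R p n1 :=
  [tuple D (lshift n3 i) w | i < n1].

Definition design (R : realType) p n (L : sample R p n) : n.-tuple (p.-tuple R) :=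
  [tuple obs L i | i < n].

(* Main.v *)
Require Import Defs.
From HB Require Import structures.
From mathcomp Require Import all_boot all_order all_algebra.
From mathcomp Require Import all_classical all_reals all_analysis.
From mathcomp Require Import measurable_realfun.
From mathcomp Require Import ring lra.

Set Implicit Arguments.
Unset Strict Implicit.
Unset Printing Implicit Defensive.

Import Order.TTheory GRing.Theory Num.Theory.
Import numFieldNormedType.Exports.

Local Open Scope classical_set_scope.
Local Open Scope ring_scope.

(** The design of the subsample is independent of the fresh pair (X, Y), so the
    conditional law of that pair coincides almost surely, on each fixed event,
    with its law Q, and [l1] is the excess risk under Q. What is left is a
    fast-rate oracle inequality for penalized empirical risk minimization over
    trees that depend on the same sample, hence a deviation bound that is
    uniform over all labelled trees.

    Uniformity comes from bracketing. The quantiles of each coordinate give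
    n + 1 sets such that every half-space {x_j <= c} contains one of them and is
    contained in its union with a strip of probability at most 1/n
    ([quantile_grid]). A function constant on the cells of a tree with D leaves
    therefore agrees, outside at most D - 1 strips, with a labelled tree having
    D leaves and splits in a fixed family of p(n + 1) sets
    ([grid_approximation]). Giving to such a grid tree the weight a^D, with
    a = 1/(8p(n + 1)), makes the total weight small ([kraft_grid_trees]), so
    that a union bound costs D ln(8p(n + 1)) for a tree with D leaves
    ([grid_event]).

    For one classifier v, let f be the difference between the error indicators
    of v and of the Bayes classifier s. Its second moment is Q(v <> s), which
    the margin condition bounds by 1/h times its mean, the excess risk of v
    ([margin_le_excess_loss]). A Chernoff bound at the fixed parameter h/4
    ([ternary_chernoff]) then compares the empirical and the true excess risk up
    to a constant factor and an additive term of order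
    (D ln(8p(n + 1)) + xi)/(nh) ([classifier_deviation]). The empirical mass of
    the strips is controlled in the same way, which transfers the comparison
    from grid trees to all trees ([bracket_arithmetic]).

    Finally the penalty dominates this additive term. The condition
    1 + ln(n/(p + 1)) >= 0 means p + 1 <= en, so ln(8p(n + 1)) is at most a
    constant plus 2 ln n, whereas d(1 + ln(n/d)) >= 1 + ln n for 1 <= d <= n
    ([grid_entropy_le]). A pair (M, T) with |M| >= n or with more than n leaves
    has a penalty of at least 3; since risks lie in [0, 1], the inequality is
    then immediate ([small_pen], [oracle_inequality_model]). *)

(** * Boolean events and real-valued probabilities *)

Section boolean_events.
Context {d : measure_display} {T : measurableType d}.

Lemma measurable_bool_fiber (f : T -> bool) (b : bool) :
  measurable_fun setT f -> measurable [set x | f x = b].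
Proof. by move=> mf; rewrite -[X in measurable X]setTI; exact: (mf measurableT [set b] I). Qed.

Lemma measurable_neqb (f g : T -> bool) :
  measurable_fun setT f -> measurable_fun setT g ->
  measurable [set x | f x != g x].
Proof.
move=> mf mg.
rewrite (_ : [set x | _] = ([set x | f x = true] `&` [set x | g x = false]) `|`
                           ([set x | f x = false] `&` [set x | g x = true])).
  by apply: measurableU; apply: measurableI; exact: measurable_bool_fiber.
by apply/seteqP; split=> x /=; case: (f x); case: (g x) => //; try by [left|right]; move=> [[]|[]].
Qed.

End boolean_events.

Section fine_probability.
Context {R : realType} {d : measure_display} {T : measurableType d}.
Variable Q : probability T R.

Lemma fine_prob_ge0 (A : set T) : 0 <= fine (Q A).
Proof. by apply: fine_ge0. Qed.

Lemma fine_probK A : measurable A -> (fine (Q A))%:E = Q A.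
Proof. by move=> mA; rewrite fineK// fin_num_measure. Qed.

Lemma fine_prob_le A B : measurable A -> measurable B -> A `<=` B ->
  fine (Q A) <= fine (Q B).
Proof.
move=> mA mB AB; rewrite fine_le ?fin_num_measure//.
by apply: le_measure => //; rewrite inE.
Qed.

Lemma fine_prob_le1 A : measurable A -> fine (Q A) <= 1.
Proof.
move=> mA; have := fine_prob_le mA measurableT (@subsetT _ A).
by rewrite probability_setT.
Qed.

Lemma fine_probU A B : measurable A -> measurable B -> A `&` B = set0 ->
  fine (Q (A `|` B)) = fine (Q A) + fine (Q B).
Proof. by move=> mA mB AB; rewrite measureU// fineD// fin_num_measure. Qed.

Lemma fine_prob_cases A B : measurable A -> measurable B ->
  fine (Q A) = fine (Q (A `&` B)) + fine (Q (A `&` ~` B)).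
Proof.
move=> mA mB; rewrite -fine_probU.
- by rewrite -setIUr setUCr setIT.
- exact: measurableI.
- by apply: measurableI => //; try exact: measurableC.
- by rewrite setIACA setICr setI0.
Qed.

Lemma fine_prob_leU A B C : measurable A -> measurable B -> measurable C ->
  A `<=` B `|` C -> fine (Q A) <= fine (Q B) + fine (Q C).
Proof.
move=> mA mB mC ABC; rewrite (fine_prob_cases mA mB) lerD//.
  by apply: fine_prob_le => //; first exact: measurableI.
apply: fine_prob_le => //; try by apply: measurableI => //; exact: measurableC.
by move=> x [/ABC[]].
Qed.

End fine_probability.

(** * Chernoff bounds for finitely valued functions *)

(** The bound holds because exp x = 1/exp(-x/2)^2 <= 1/(1 - x/2)^2. *)
Lemma expR_le_quad (R : realType) (x : R) : -1 <= x <= 1 ->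
  expR x <= 1 + x + 2 * x ^+ 2.
Proof.
move=> /andP[x1 x2].
have hN : 1 - x / 2 <= expR (- (x / 2)) by have := expR_ge1Dx (- (x / 2)).
have h0 : 0 < 1 - x / 2 by lra.
have -> : expR x = (expR (- (x / 2)) ^+ 2)^-1.
  by rewrite -expRM_natl -expRN; congr expR; field.
have hsq : (1 - x / 2) ^+ 2 <= expR (- (x / 2)) ^+ 2.
  by rewrite ler_sqr ?nnegrE ?expR_ge0// ltW.
apply: (@le_trans _ _ ((1 - x / 2) ^+ 2)^-1).
  by rewrite lef_pV2// posrE exprn_gt0// expR_gt0.
rewrite invf_ple ?posrE ?exprn_gt0//; last by nra.
rewrite -[leLHS]mul1r ler_pdivrMr; last by nra.
(* (1 - x/2)^2 (1 + x + 2x^2) - 1 = x^2 (x - 1) (x - 5/2) / 2. *)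
have : 0 <= x ^+ 2 * ((x - 1) * (x - 5 / 2)).
  by rewrite mulr_ge0 ?sqr_ge0//; nra.
nra.
Qed.

Section deviation.
Context {R : realType} {d dE : measure_display} {Omega : measurableType d}.
Context {E : measurableType dE}.
Variables (P : probability Omega R) (Q : probability E R).

Lemma measure_finite_union_le (K : finType) (A : set Omega)
    (B : K -> set Omega) (b : K -> R) :
  measurable A -> (forall k, measurable (B k)) ->
  (forall w, A w -> exists k, B k w) -> (forall k, (P (B k) <= (b k)%:E)%E) ->
  (P A <= (\sum_k b k)%:E)%E.
Proof.
move=> mA mB AB Pb.
pose C (i : nat) : set Omega := if insub i is Some k then B (enum_val (k : 'I_#|K|)) else set0.
have mC i : measurable (C i) by rewrite /C; case: insubP.
apply: (le_trans (y := (\sum_(i < #|K|) P (C i))%E)).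
  apply: content_subadditive => //.
  move=> w /AB[k Bk]; rewrite -bigcup_mkord; exists (enum_rank k) => /=.
    exact: ltn_ord.
  by rewrite /C valK enum_rankK.
rewrite (reindex (@enum_val K predT)) /=; last by apply: onW_bij; exact: enum_val_bij.
rewrite -sumEFin lee_sum// => i _.
by rewrite /C valK.
Qed.

(** The sample space splits according to the cells visited by the Z_i. The
    probability of each pattern is a product by independence, and the indicator
    of an exceedance is at most exp(lam (sum - t)) on it; summing over all
    patterns rebuilds the n-th power of the moment generating function. Working
    with the finitely many patterns replaces the expectation of a product. *)
Lemma finite_valued_chernoff (K : finType) (cell : K -> set E) (v : K -> R)
    (g : E -> R) n (Zs : 'I_n -> Omega -> E) (lam t : R) :
  (forall k, measurable (cell k)) ->
  (forall e, exists k, cell k e) -> (forall k e, cell k e -> g e = v k) ->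
  (forall i B, measurable B -> measurable (Zs i @^-1` B)) ->
  (forall B : 'I_n -> set E, (forall i, measurable (B i)) ->
    P [set w | forall i, B i (Zs i w)] = (\prod_i Q (B i))%E) ->
  0 <= lam ->
  measurable [set w | (t < \sum_i g (Zs i w))%R] ->
  (P [set w | (t < \sum_i g (Zs i w))%R] <=
    (expR (- (lam * t)) * (\sum_k fine (Q (cell k)) * expR (lam * v k)) ^+ n)%:E)%E.
Proof.
move=> mcell covcell gcell mZ indep lam0 mA.
pose pat (f : {ffun 'I_n -> K}) : set Omega :=
  [set w | (t < \sum_i v (f i))%R /\ forall i : 'I_n, cell (f i) (Zs i w)].
have -> : expR (- (lam * t)) * (\sum_k fine (Q (cell k)) * expR (lam * v k)) ^+ n
    = \sum_(f : {ffun 'I_n -> K}) expR (- (lam * t)) *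
        \prod_i (fine (Q (cell (f i))) * expR (lam * v (f i))).
  rewrite -mulr_sumr; congr *%R.
  rewrite -(bigA_distr_bigA (fun _ k => fine (Q (cell k)) * expR (lam * v k))).
  by rewrite prodr_const card_ord.
have pat0 (f : {ffun 'I_n -> K}) : ~ (t < \sum_i v (f i))%R -> pat f = set0.
  by move=> nt; rewrite -subset0 => w [].
have pat1 (f : {ffun 'I_n -> K}) : (t < \sum_i v (f i))%R ->
    pat f = [set w | forall i : 'I_n, cell (f i) (Zs i w)].
  by move=> tv; apply/seteqP; split=> w //= [].
apply: (measure_finite_union_le (B := pat)) => //.
- move=> f; have [tv|ntv] := pselect (t < \sum_i v (f i))%R; last by rewrite pat0.
  rewrite pat1// (_ : [set w | _] = \bigcap_(i in setT) (Zs i @^-1` cell (f i))).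
    by apply: fin_bigcap_measurable => // i _; exact: mZ.
  by apply/seteqP; split=> w h => [i _|i]; [exact: h|exact: (h i I)].
- move=> w /= tw; have /choice[f hf] i := covcell (Zs i w).
  exists [ffun i => f i]; split=> [|i]; last by rewrite ffunE; exact: hf.
  by under eq_bigr => i _ do rewrite ffunE -(gcell _ _ (hf i)).
move=> f; have [tv|ntv] := pselect (t < \sum_i v (f i))%R; last first.
  rewrite pat0// measure0 lee_fin mulr_ge0 ?expR_ge0//.
  by rewrite prodr_ge0// => i _; rewrite mulr_ge0 ?expR_ge0 ?fine_ge0.
rewrite pat1// (indep (fun i => cell (f i)))// big_split/= mulrCA.
have -> : (\prod_i Q (cell (f i)) = (\prod_i fine (Q (cell (f i))))%:E)%E.
  elim/big_ind2: _ => [//|x y x' y' -> ->|i _]; first by rewrite EFinM.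
  by rewrite fineK// fin_num_measure.
rewrite lee_fin ler_peMr//; first by rewrite prodr_ge0// => i _; rewrite fine_ge0.
have -> : \prod_i expR (lam * v (f i)) = expR (lam * \sum_i v (f i)).
  by rewrite mulr_sumr expR_sum.
rewrite -expRD -expR0 ler_expR addrC subr_ge0.
by rewrite ler_wpM2l// ltW.
Qed.

(** With q1 = Q(g = 1) and qN = Q(g = -1), the mean of g is q1 - qN and its
    second moment is q1 + qN. The parameter lam is left free, so that the second
    moment term can be made a small fraction of the mean. *)
Lemma ternary_chernoff (g : E -> R) n (Zs : 'I_n -> Omega -> E) (lam x : R) :
  measurable_fun setT g -> (forall e, [\/ g e = 0, g e = 1 | g e = -1]) ->
  (forall i, measurable_fun setT (Zs i)) ->
  (forall B : 'I_n -> set E, (forall i, measurable (B i)) ->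
    P [set w | forall i, B i (Zs i w)] = (\prod_i Q (B i))%E) ->
  0 < lam <= 1 ->
  (P [set w | (n%:R * (fine (Q (g @^-1` [set 1])) - fine (Q (g @^-1` [set -1])) +
        2 * lam * (fine (Q (g @^-1` [set 1])) + fine (Q (g @^-1` [set -1])))) + x / lam <
               \sum_i g (Zs i w))%R] <= (expR (- x))%:E)%E.
Proof.
move=> mg gv mZ indep /andP[l0 l1].
set q1 := fine (Q (g @^-1` [set 1])); set qN := fine (Q (g @^-1` [set -1])).
pose v (k : 'I_3) : R := nth 0 [:: 0; 1; -1] k.
set t := _ + _.
have mcell k : measurable (g @^-1` [set v k]).
  by rewrite -[X in measurable X]setTI; exact: mg.
have qge k : 0 <= fine (Q (g @^-1` [set v k])) by rewrite fine_ge0.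
have mS : measurable_fun setT (fun w => \sum_i g (Zs i w)).
  by apply: measurable_sum => i; exact: measurableT_comp.
have qsum : fine (Q (g @^-1` [set 0])) + q1 + qN = 1.
  have : Q (g @^-1` [set 0] `|` g @^-1` [set 1] `|` g @^-1` [set -1]) = 1%E.
    rewrite (_ : _ `|` _ = setT) ?probability_setT//.
    by apply/seteqP; split=> e // _; case: (gv e) => h; [left;left|left;right|right].
  have m0 := mcell 0; have m1 := mcell 1; have mN := mcell ord_max.
  rewrite measureU//; [|exact: measurableU|]; last first.
    by rewrite -subset0 => e /= [[->|->]]; lra.
  rewrite measureU//; last by rewrite -subset0 => e /= [->]; lra.
  move=> sum1; apply/eqP; rewrite -eqe !EFinD /q1 /qN !fineK ?fin_num_measure//.
  by apply/eqP.
have cov e : exists k, (g @^-1` [set v k]) e.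
  by case: (gv e); [exists 0|exists 1|exists ord_max].
have mA : measurable [set w | (t < \sum_i g (Zs i w))%R].
  rewrite -[X in measurable X]setTI.
  have mlt : measurable_fun setT (fun w => (t < \sum_i g (Zs i w))%R).
    exact: (measurable_fun_ltr (measurable_cst t) mS).
  by have := mlt measurableT [set true] I.
have mZB i B : measurable B -> measurable (Zs i @^-1` B).
  by move=> mB; rewrite -[X in measurable X]setTI; exact: mZ.
apply: le_trans.
  by apply: (finite_valued_chernoff (v := v) (lam := lam)
    (cell := fun k => g @^-1` [set v k])) => //; exact: ltW.
rewrite lee_fin !big_ord_recl big_ord0 /= /v /= -/q1 -/qN.
set S := (X in X ^+ n).
have lam0 : lam != 0 by rewrite gt_eqF.
pose y := lam * (q1 - qN) + 2 * lam ^+ 2 * (q1 + qN).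
have tE : lam * t = n%:R * y + x by rewrite /t /y; field.
have SE : S <= expR y.
  have q1ge := qge 1; have qNge := qge ord_max; rewrite -/q1 in q1ge; rewrite -/qN in qNge.
  apply: le_trans (expR_ge1Dx y).
  have -> : S = fine (Q (g @^-1` [set 0])) + q1 * expR lam + qN * expR (- lam).
    by rewrite /S mulr0 expR0 !mulr1 addr0 mulrN1 addrA.
  have e1 := @expR_le_quad _ lam; have eN := @expR_le_quad _ (- lam).
  have {}e1 : q1 * expR lam <= q1 * (1 + lam + 2 * lam ^+ 2).
    by apply: ler_wpM2l => //; apply: e1; lra.
  have {}eN : qN * expR (- lam) <= qN * (1 + - lam + 2 * lam ^+ 2).
    by apply: ler_wpM2l => //; rewrite -(sqrrN lam); apply: eN; lra.
  rewrite /y; lra.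
have S0 : 0 <= S.
  by rewrite /S !addr_ge0 ?mulr_ge0 ?expR_ge0//;
    [exact: (qge 0)|exact: (qge 1)|exact: (qge ord_max)].
apply: (@le_trans _ _ (expR (- (lam * t)) * expR y ^+ n)).
  by rewrite ler_wpM2l ?expR_ge0// lerXn2r ?nnegrE ?expR_ge0.
by rewrite -expRM_natl -expRD tE ler_expR; lra.
Qed.
End deviation.

(** * The margin condition *)

Section pair.
Context {R : realType} {d d1 d2 : measure_display} {Omega : measurableType d}.
Context {T1 : measurableType d1} {T2 : measurableType d2}.
Context {P : probability Omega R}.

Definition pair_RV (X : {RV P >-> T1}) (Y : {RV P >-> T2}) (w : Omega) : T1 * T2 :=
  (X w, Y w).

HB.instance Definition _ X Y := isMeasurableFun.Build _ _ _ _ (pair_RV X Y)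
  (measurable_fun_pair (measurable_funPT X) (measurable_funPT Y)).

End pair.

Section margin.
Context {R : realType} {d : measure_display} {Omega : measurableType d}.
Context {P : probability Omega R} {p : nat}.
Context {X : {RV P >-> p.-tuple R}} {Y : {RV P >-> bool}}.
Context {eta : p.-tuple R -> R}.
Hypothesis etaP : regression_function X Y eta.

Let Q : probability (p.-tuple R * bool)%type R := distribution P (pair_RV X Y).

Lemma regression_measurable : measurable_fun setT eta.
Proof. by case: etaP => /integrableP[/measurable_EFinP]. Qed.

Lemma measurable_bayes : measurable_fun setT (bayes eta).
Proof.
apply: (measurable_fun_bool true).
have := measurable_fun_ler (measurable_cst (2^-1 : R)) regression_measurable.
by move/(_ measurableT [set true] I).
Qed.

Lemma label_massE (A : set (p.-tuple R)) : measurable A ->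
  Q [set z : p.-tuple R * bool | A z.1 /\ z.2 = true] =
  (\int[distribution P X]_(x in A) (eta x)%:E)%E.
Proof.
move=> mA; case: etaP => _ <-//.
have mY : measurable [set w | Y w = true].
  by apply: measurable_bool_fiber; exact: measurable_funPT.
have mXA : measurable (X @^-1` A).
  by rewrite -[X in measurable X]setTI; exact: measurable_funPT.
under eq_integral => w _.
  rewrite (_ : (Y w)%:R = \1_[set w | Y w = true] w); last first.
    by rewrite indicE; congr (nat_of_bool _)%:R; apply/idP/idP; rewrite inE.
  over.
rewrite integral_indic//.
by congr (P _); apply/seteqP; split=> w [].
Qed.

Lemma feature_massE (A : set (p.-tuple R)) :
  Q [set z : p.-tuple R * bool | A z.1] = distribution P X A.
Proof. by []. Qed.

(** A pointwise bound on the regression function becomes a bound on the mass of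
    the label 1 above a set of features: the two sides are integrals over A of a
    constant and of eta. *)
Lemma label_mass_ge (A : set (p.-tuple R)) c : measurable A -> (forall x, A x -> c <= eta x) ->
  c * fine (Q [set z : p.-tuple R * bool | A z.1]) <=
  fine (Q [set z : p.-tuple R * bool | A z.1 /\ z.2 = true]).
Proof.
move=> mA Ac.
rewrite label_massE// feature_massE.
have iA : (distribution P X).-integrable A (EFin \o eta).
  by case: etaP => + _; apply: integrableS.
rewrite -lee_fin EFinM fine_probK// fineK; last exact: integrable_fin_num.
rewrite -integral_cst//; apply: le_integral => //.
  exact: finite_measure_integrable_cst.
by move=> x; rewrite inE lee_fin => /Ac.
Qed.

Lemma label_mass_le (A : set (p.-tuple R)) c : measurable A -> (forall x, A x -> eta x <= c) ->
  fine (Q [set z : p.-tuple R * bool | A z.1 /\ z.2 = true]) <=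
  c * fine (Q [set z : p.-tuple R * bool | A z.1]).
Proof.
move=> mA Ac.
rewrite label_massE// feature_massE.
have iA : (distribution P X).-integrable A (EFin \o eta).
  by case: etaP => + _; apply: integrableS.
rewrite -lee_fin EFinM fine_probK// fineK; last exact: integrable_fin_num.
rewrite -integral_cst//; apply: le_integral => //.
  exact: finite_measure_integrable_cst.
by move=> x; rewrite inE lee_fin => /Ac.
Qed.

Variable h : R.
Hypothesis eta_margin : forall x, h <= `|2 * eta x - 1|.

Let mfst : measurable_fun setT (fst : p.-tuple R * bool -> _) := measurable_fst.

(** The errors of u and s differ only where u and s disagree. On the part where
    s = 1, the excess is the integral of 2 eta - 1 >= h; on the part where s = 0,
    it is the integral of 1 - 2 eta >= h. *)
Lemma margin_le_excess_loss (u : p.-tuple R -> bool) : measurable_fun setT u ->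
  h * fine (Q [set z : p.-tuple R * bool | u z.1 != bayes eta z.1]) <=
  excess_loss Q (bayes eta) u.
Proof.
move=> mu; have ms := measurable_bayes; set s := bayes eta in ms *.
pose D b : set (p.-tuple R) := [set x | s x = b] `&` [set x | u x = ~~ b].
have mD b : measurable (D b) by apply: measurableI; exact: measurable_bool_fiber.
pose DX b := [set z : p.-tuple R * bool | D b z.1].
have mfD B : measurable B -> measurable [set z : p.-tuple R * bool | B z.1].
  by move=> mB; rewrite -[X in measurable X]setTI; exact: (mfst measurableT mB).
pose DY b y := [set z : p.-tuple R * bool | D b z.1 /\ z.2 = y].
have mDY b y : measurable (DY b y).
  apply: (measurableI (DX b)); first exact: mfD.
  exact: measurable_bool_fiber.
have mDX b : measurable (DX b) by exact: mfD.
have DXE b : fine (Q (DX b)) = fine (Q (DY b true)) + fine (Q (DY b false)).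
  rewrite -fine_probU//; last by rewrite -subset0 => z [[_ /= z2] [_ /=]]; rewrite z2.
  congr (fine (Q _)); apply/seteqP; split=> z.
    by rewrite /DX/DY /=; case: (z.2) => ?; [left|right].
  by case=> -[].
pose err (v : p.-tuple R -> bool) := [set z : p.-tuple R * bool | v z.1 != z.2].
have merr v : measurable_fun setT v -> measurable (err v).
  by move=> mv; apply: (@measurable_neqb _ _ (v \o fst)) => //; exact: measurableT_comp.
pose C := err u `&` err s.
have mC : measurable C by apply: measurableI; exact: merr.
have uE : fine (Q (err u)) = fine (Q C) + (fine (Q (DY true true)) + fine (Q (DY false false))).
  rewrite -!fine_probU//.
  - congr (fine (Q _)); apply/seteqP; split=> z; rewrite /C /err /DY /D /=.
      by case: (u z.1); case: (s z.1); case: (z.2) => //=; intuition discriminate.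
    by case: (u z.1); case: (s z.1); case: (z.2) => //=; intuition discriminate.
  - exact: measurableU.
  - rewrite -subset0 => z; rewrite /C /err /DY /D /=.
    by case: (u z.1); case: (s z.1); case: (z.2) => //=; intuition discriminate.
  - rewrite -subset0 => z; rewrite /C /err /DY /D /=.
    by case: (u z.1); case: (s z.1); case: (z.2) => //=; intuition discriminate.
have sE : fine (Q (err s)) = fine (Q C) + (fine (Q (DY true false)) + fine (Q (DY false true))).
  rewrite -!fine_probU//.
  - congr (fine (Q _)); apply/seteqP; split=> z; rewrite /C /err /DY /D /=.
      by case: (u z.1); case: (s z.1); case: (z.2) => //=; intuition discriminate.
    by case: (u z.1); case: (s z.1); case: (z.2) => //=; intuition discriminate.
  - exact: measurableU.
  - rewrite -subset0 => z; rewrite /C /err /DY /D /=.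
    by case: (u z.1); case: (s z.1); case: (z.2) => //=; intuition discriminate.
  - rewrite -subset0 => z; rewrite /C /err /DY /D /=.
    by case: (u z.1); case: (s z.1); case: (z.2) => //=; intuition discriminate.
have diffE : fine (Q [set z : p.-tuple R * bool | u z.1 != s z.1]) =
    fine (Q (DX true)) + fine (Q (DX false)).
  rewrite -!fine_probU//.
  - congr (fine (Q _)); apply/seteqP; split=> z; rewrite /DX /D /=.
      by case: (u z.1); case: (s z.1) => //=; intuition discriminate.
    by case: (u z.1); case: (s z.1) => //=; intuition discriminate.
  - by rewrite -subset0 => z; rewrite /DX /D /= => -[[-> _] []].
have h1 : (1 + h) / 2 * fine (Q (DX true)) <= fine (Q (DY true true)).
  apply: label_mass_ge => // x [/= sx _].
  have := eta_margin x; rewrite /s /bayes in sx; rewrite ger0_norm; lra.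
have h0 : fine (Q (DY false true)) <= (1 - h) / 2 * fine (Q (DX false)).
  apply: label_mass_le => // x [/= sx _].
  have {}sx : eta x < 2^-1 by rewrite ltNge; apply/negP => sx1; rewrite /s /bayes sx1 in sx.
  have := eta_margin x; rewrite ltr0_norm; lra.
have X1 := DXE true; have X0 := DXE false.
rewrite /excess_loss -/(err u) -/(err s) uE sE diffE; lra.
Qed.

(** The complement of the Bayes classifier disagrees with it everywhere, while
    an excess risk is at most 1. *)
Lemma margin_le1 : h <= 1.
Proof.
have mN : measurable_fun setT (fun x => ~~ bayes eta x).
  apply: (measurable_fun_bool true); rewrite setTI.
  rewrite (_ : _ @^-1` _ = [set x | bayes eta x = false]).
    exact: measurable_bool_fiber measurable_bayes.
  by apply/seteqP; split=> x /=; case: (bayes eta x).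
have := margin_le_excess_loss mN.
rewrite (_ : [set z | _] = setT); last first.
  by apply/seteqP; split=> z //= _; case: (bayes _ _).
rewrite probability_setT /= mulr1 => /le_trans; apply.
rewrite /excess_loss lerBlDr (le_trans (y := 1))//; last by rewrite lerDl; apply: fine_ge0.
apply: fine_prob_le1.
by apply: (@measurable_neqb _ _ ((fun x => ~~ bayes eta x) \o fst)) => //; exact: measurableT_comp.
Qed.

End margin.

(** * Quantile grids *)

Section quantile_grid.
Context {R : realType} {d : measure_display} {T : measurableType d}.
Variable Q : probability T R.

(** A finite union of members of a chain is one of them, so the bound passes to
    the countable union by continuity from below. Indexing by the rationals
    suits the level sets of a distribution function. *)
Lemma chain_bigcup_measure_le (B : rat -> set T) (r : R) :
  0 <= r -> (forall q, measurable (B q)) ->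
  (forall q q', B q `<=` B q' \/ B q' `<=` B q) ->
  (forall q, fine (Q (B q)) <= r) -> fine (Q (\bigcup_q B q)) <= r.
Proof.
move=> r0 mB chain Br.
pose G m : set T := \bigcup_(i < m) (if unpickle i is Some q then B q else set0).
have mi i : measurable (if unpickle i is Some q then B q else set0) by case: unpickle.
have mG m : measurable (G m) by apply: bigcup_measurable => i _; exact: mi.
have UE : \bigcup_q B q = \bigcup_m G m.
  apply/seteqP; split=> x [].
    move=> q _ Bx; exists (pickle q).+1 => //; exists (pickle q) => /=.
      exact: ltnSn.
    by rewrite pickleK.
  by move=> m _ [i _]; case: unpickle => // q Bx; exists q.
have Gchain m : G m = set0 \/ exists q, G m = B q.
  elim: m => [|m IH]; first by left; rewrite /G bigcup_mkord big_ord0.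
  have -> : G m.+1 = G m `|` (if unpickle m is Some q then B q else set0).
    by rewrite /G !bigcup_mkord big_ord_recr.
  case: (unpickle m) => [q|]; last by rewrite setU0.
  case: IH => [->|[q' ->]]; first by rewrite set0U; right; exists q.
  by right; have [/setUidPr ->|/setUidPl ->] := chain q' q; [exists q|exists q'].
have Gr m : fine (Q (G m)) <= r.
  by case: (Gchain m) => [->|[q ->]//]; rewrite measure0.
have mU : measurable (\bigcup_m G m) by apply: bigcup_measurable.
have hom : {homo G : n m / (n <= m)%N >-> (n <= m)%O}.
  by move=> a b ab; apply/subsetPset => x [i /= ia Bx]; exists i => //=; exact: leq_trans ab.
have cv := nondecreasing_cvg_mu (mu := Q) mG mU hom.
rewrite UE -lee_fin fine_probK// -(cvg_lim _ cv)//.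
apply: lime_le; first by apply/cvg_ex; eexists; exact: cv.
by near=> m; rewrite /= -fine_probK// lee_fin.
Unshelve. all: by end_near. Qed.

Variable f : T -> R.
Hypothesis mf : measurable_fun setT f.

Let F (c : R) : R := fine (Q [set x | f x <= c]).

Let mle c : measurable [set x | f x <= c].
Proof.
have mc : measurable_fun setT (fun x => f x <= c).
  exact: measurable_fun_ler mf (measurable_cst c).
exact: measurable_bool_fiber mc.
Qed.

Let F_homo : {homo F : c c' / c <= c'}.
Proof.
by move=> c c' cc; apply: fine_prob_le => //= x /=; move=> /le_trans; apply.
Qed.

Let F_right c r : F c < r -> exists2 c', c < c' & F c' < r.
Proof.
move=> cr.
pose f' : {RV Q >-> R} := HB.pack f (isMeasurableFun.Build _ _ _ _ f mf).
have cdfE x : cdf f' x = (F x)%:E.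
  by rewrite /cdf /distribution /= /pushforward /F fine_probK//; congr (Q _);
     apply/seteqP; split => y; rewrite /= in_itv.
have := @cdf_right_continuous _ _ _ _ f' c.
rewrite cdfE => /fine_cvgP[_] cv.
have : \forall y \near c^'+, F y < r.
  move/cvgr_lt : cv => /(_ _ cr); apply: filterS => y /=.
  by rewrite cdfE.
move=> near_r; near c^'+ => c'; exists c'; last by near: c'.
by near: c'; exact: nbhs_right_gt.
Unshelve. all: by end_near.
Qed.

(** The sets are A_k = {f <= q_k} and S_k = {q_k < f < q_(k+1)}, where q_k is the
    quantile of order k/n of f. A possible atom at q_k goes to A_k, so that S_k
    has mass at most 1/n whatever the law of f. A threshold c uses the index
    k = trunc(n F(c)). *)
Lemma quantile_grid (n : nat) : (0 < n)%N ->
  exists A S : 'I_n.+1 -> set T,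
    [/\ forall k, measurable (A k), forall k, measurable (S k),
        forall k, fine (Q (S k)) <= n%:R^-1 &
        forall c, exists k, A k `<=` [set x | f x <= c] /\
                            [set x | f x <= c] `<=` A k `|` S k].
Proof.
move=> n0.
(* A r is {f <= quantile of order r}; V r contains every {f <= c} with F c < r. *)
pose A (r : R) : set T := [set x | forall c, r <= F c -> f x <= c].
pose V (r : R) : set T := [set x | F (f x) < r].
have AE r : ~` A r = \bigcup_(q : rat) [set x | r <= F (ratr q) /\ ratr q < f x].
  apply/seteqP; split=> x.
    move=> /existsNP[c] /not_implyP[rc /negP]; rewrite -ltNge => cx.
    have [q] := rat_in_itvoo cx; rewrite in_itv/= => /andP[cq qx].
    by exists q => //; split=> //; rewrite (le_trans rc)// F_homo// ltW.
  by move=> [q _ [rq qx]] /(_ _ rq); rewrite leNgt qx.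
have VE r : V r = \bigcup_(q : rat) [set x | F (ratr q) < r /\ f x <= ratr q].
  apply/seteqP; split=> x.
    move=> /F_right[c' xc' c'r].
    have [q] := rat_in_itvoo xc'; rewrite in_itv/= => /andP[xq qc].
    by exists q => //; split; [rewrite (le_lt_trans _ c'r)// F_homo// ltW|exact: ltW].
  by move=> [q _ [qr xq]]; rewrite /V /= (le_lt_trans _ qr)// F_homo.
have gtE q : [set x | q < f x] = ~` [set x | f x <= q].
  by apply/seteqP; split=> x /=; [move=> h; apply/negP; rewrite -ltNge|move/negP; rewrite -ltNge].
have mANr r q : measurable [set x | r <= F (ratr q) /\ (ratr q < f x)%R].
  have [rq|nrq] := pselect (r <= F (ratr q)).
    rewrite (_ : [set x | _] = [set x | (ratr q < f x)%R]).
      by rewrite gtE; exact: measurableC.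
    by apply/seteqP; split=> x //= -[].
  by rewrite (_ : [set x | _] = set0)// -subset0 => x [].
have mVq r q : measurable [set x | (F (ratr q) < r)%R /\ f x <= ratr q].
  have [rq|nrq] := pselect (F (ratr q) < r).
    rewrite (_ : [set x | _] = [set x | (f x <= ratr q)%R])//.
    by apply/seteqP; split=> x //= -[].
  by rewrite (_ : [set x | _] = set0)// -subset0 => x [].
have ctr : countable [set: rat] by exact: countableP.
have mA r : measurable (A r).
  by rewrite -[A r]setCK AE; apply: measurableC; exact: countable_bigcupT_measurable.
have mV r : measurable (V r) by rewrite VE; exact: countable_bigcupT_measurable.
have Vle r : 0 <= r -> fine (Q (V r)) <= r.
  move=> r0; rewrite VE; apply: chain_bigcup_measure_le => //.
    move=> q q'; have [qq|qq] := leP (ratr q : R) (ratr q').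
      have [h|h] := ltP (F (ratr q')) r.
        by left=> x /= [_ xq]; split=> //; exact: le_trans qq.
      by right=> x /= [].
    have [h|h] := ltP (F (ratr q)) r.
      by right=> x /= [_ xq]; split=> //; exact: le_trans (ltW qq).
    by left=> x /= [].
  move=> q; have [h|h] := ltP (F (ratr q)) r.
    apply: le_trans (ltW h); apply: fine_prob_le => //; last by move=> x [].
    by have := mVq r q; rewrite h.
  rewrite (_ : [set x | _] = set0) ?measure0//.
  by rewrite -subset0 => x [].
have Age r : r <= 1 -> r <= fine (Q (A r)).
  move=> r1; suff : fine (Q (~` A r)) <= 1 - r.
    have := fine_prob_cases Q measurableT (mA r); rewrite !setTI probability_setT/=; lra.
  rewrite AE; apply: chain_bigcup_measure_le => //; first by lra.
    move=> q q'; have [qq|qq] := leP (ratr q : R) (ratr q').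
      have [h|h] := leP r (F (ratr q)).
        by right=> x /= [_ xq]; split=> //; exact: le_lt_trans xq.
      by left=> x /= [].
    have [h|h] := leP r (F (ratr q')).
      by left=> x /= [_ xq]; split=> //; exact: lt_trans xq.
    by right=> x /= [].
  move=> q; have [h|h] := leP r (F (ratr q)); last first.
    rewrite (_ : [set x | _] = set0) ?measure0 ?subr_ge0//.
    by rewrite -subset0 => x [].
  apply: (@le_trans _ _ (fine (Q [set x | (ratr q < f x)%R]))).
    apply: fine_prob_le => //; last by move=> x [].
      by have := mANr r q; rewrite h.
    by rewrite gtE; exact: measurableC.
  have := fine_prob_cases Q measurableT (mle (ratr q)).
  rewrite !setTI probability_setT/= -gtE -/(F _); lra.
exists (fun k => A (k%:R / n%:R)), (fun k => V (k.+1%:R / n%:R) `\` A (k%:R / n%:R)).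
have n0' : 0 < n%:R :> R by rewrite ltr0n.
split=> [k|k|k|c].
- exact: mA.
- exact: measurableD.
- have kn : (k%:R / n%:R : R) <= 1 by rewrite ler_pdivrMr// mul1r ler_nat -ltnS ltn_ord.
  set a := _ / _ in kn *; set b := _ / _.
  have bE : b = a + n%:R^-1 by rewrite /b /a -natr1 mulrDl mul1r.
  have a0 : 0 <= a by rewrite divr_ge0.
  (* Both sets are initial segments for f: either A is inside V, and the masses
     subtract, or V is inside A, and the strip is empty. *)
  have [AV|/nonsubset[x [Ax nVx]]] := pselect (A a `<=` V b).
    have := fine_prob_cases Q (mV b) (mA a); rewrite -setDE (setIidr AV).
    have := Vle b; have := Age _ kn; have : 0 < n%:R^-1 :> R by rewrite invr_gt0.
    rewrite bE; lra.
  rewrite (_ : _ `\` _ = set0) ?measure0 ?invr_ge0//.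
  rewrite -subset0 => y [Vy]; apply => c /Ax xc.
  apply: le_trans xc; rewrite leNgt; apply/negP => xy; apply: nVx.
  by rewrite /V /= (le_lt_trans _ Vy)// F_homo// ltW.
have F01 : 0 <= F c <= 1 by rewrite /F fine_ge0// fine_prob_le1.
have nF0 : 0 <= n%:R * F c by rewrite mulr_ge0//; case/andP: F01.
have /andP[t1 t2] := Num.Theory.truncn_itv nF0.
have tn : (Num.trunc (n%:R * F c) < n.+1)%N.
  rewrite ltnS -(ler_nat R) (le_trans t1)// ler_piMr//; by case/andP: F01.
exists (Ordinal tn) => /=; split=> x.
  by move=> /(_ c); apply; rewrite ler_pdivrMr// [leRHS]mulrC.
move=> /= xc; have [Ax|nAx] := pselect (A ((Num.trunc (n%:R * F c))%:R / n%:R) x).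
  by left.
right; split=> //; rewrite /V /= ltr_pdivlMr// [ltLHS]mulrC.
by apply: le_lt_trans t2; rewrite ler_wpM2l ?ler0n// F_homo.
Qed.

End quantile_grid.

(** * Conditional laws given an independent variable *)

Section conditional_law_of_independent.
Context {R : realType} {d d1 d2 : measure_display} {Omega : measurableType d}.
Context {T1 : measurableType d1} {T2 : measurableType d2}.
Variable P : probability Omega R.

Definition rectangles n : set (set (n.-tuple T1)) :=
  [set A | exists2 B : 'I_n -> set T1, (forall i, measurable (B i)) &
           A = [set x | forall i, B i (tnth x i)]].

(** Rectangles generate the sigma-algebra of the coordinates and are stable
    under intersection, which is what the uniqueness of measures requires. *)
Lemma measurable_rectangles n : measurable = <<s @rectangles n >>.
Proof.
have rect_meas (A : set (n.-tuple T1)) : rectangles A -> measurable A.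
  move=> [B mB ->]; rewrite (_ : [set x | _] = \bigcap_(i in setT) ((fun x => tnth x i) @^-1` B i)).
    apply: fin_bigcap_measurable => // i _.
    by rewrite -[X in measurable X]setTI; exact: measurable_tnth.
  by apply/seteqP; split=> x h => [i _|i]; [exact: h|exact: (h i I)].
apply/seteqP; split; last first.
  by apply: smallest_sub; [exact: sigma_algebra_measurable|exact: rect_meas].
apply: smallest_sub; first exact: smallest_sigma_algebra.
move=> A; rewrite -bigcup_seq/= => -[i _ [B mB <-]].
apply: sub_sigma_algebra; exists (fun j => if j == i then B else setT).
  by move=> j; case: ifP.
rewrite setTI; apply/seteqP; split=> x /=.
  by move=> Bx j; case: eqP => // ->.
by move=> /(_ i); rewrite eqxx.
Qed.

(** Both sides are finite measures in A that agree on rectangles. *)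
Lemma independent_of_rectangles n (U : {mfun Omega >-> n.-tuple T1}) (C : set Omega) (c : R) :
  measurable C -> 0 <= c ->
  (forall B : 'I_n -> set T1, (forall i, measurable (B i)) ->
    P ([set w | forall i, B i (tnth (U w) i)] `&` C) =
    (P [set w | forall i, B i (tnth (U w) i)] * c%:E)%E) ->
  forall A, measurable A -> P (U @^-1` A `&` C) = (P (U @^-1` A) * c%:E)%E.
Proof.
move=> mC c0 rectE A mA.
have := @measure_unique _ R _ (@rectangles n) (fun=> setT) (@measurable_rectangles n) _ _ _
  (pushforward (mrestr P mC) U) (mscale (NngNum c0) (distribution P U)) _ _ A mA.
rewrite /pushforward /mrestr /mscale /= muleC; apply => //.
- move=> _ _ [B mB ->] [B' mB' ->]; exists (fun i => B i `&` B' i).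
    by move=> i; exact: measurableI.
  by apply/seteqP; split=> x /= => [[h h'] i|h]; [split|split=> i; case: (h i)].
- by move=> _; exists (fun=> setT) => //; apply/seteqP.
- by rewrite bigcup_const.
- by move=> _ [B mB ->]; rewrite [RHS]muleC -rectE.
- by move=> _; rewrite /pushforward /mrestr preimage_setT setTI ltey_eq fin_num_measure.
Qed.

(** By independence the constant P(V in B) and the kernel have the same integral
    over every event {U in A}, so they are almost surely equal. The null set
    depends on B, so agreement holds simultaneously on countably many
    events. *)
Lemma conditional_law_independent (E1 : measurableType d1) (U : {mfun Omega >-> E1})
    (V : {mfun Omega >-> T2})
    (kappa : R.-pker E1 ~> T2) (B : set T2) : measurable B ->
  (forall A, measurable A -> P (U @^-1` A `&` V @^-1` B) = (P (U @^-1` A) * P (V @^-1` B))%E) ->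
  conditional_law P V U kappa ->
  measurable [set w | kappa (U w) B != P (V @^-1` B)] /\
  P [set w | kappa (U w) B != P (V @^-1` B)] = 0%E.
Proof.
move=> mB indep condK.
have mk : measurable_fun setT (fun x => kappa x B) by exact: measurable_kernel.
pose N := [set x : E1 | kappa x B != P (V @^-1` B)].
have mN : measurable N.
  rewrite (_ : N = ~` ((fun x => kappa x B) @^-1` [set P (V @^-1` B)])).
    apply: measurableC; rewrite -[X in measurable X]setTI.
    by apply: mk => //; exact: emeasurable_set1.
  by apply/seteqP; split=> x /eqP.
have mUN : measurable (U @^-1` N) by rewrite -[X in measurable X]setTI; exact: measurable_funPT.
split => //.
have fB : P (V @^-1` B) \is a fin_num.
  by rewrite fin_num_measure// -[X in measurable X]setTI; exact: measurable_funPT.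
have : ae_eq (distribution P U) setT (cst (P (V @^-1` B))) (fun x => kappa x B).
  apply: integral_ae_eq => //.
    by rewrite -(fineK fB); exact: finite_measure_integrable_cst.
  move=> A _ mA; rewrite integral_cst//.
  rewrite ge0_integral_pushforward//; last exact: measurable_funTS.
  rewrite muleC -condK//. exact/esym/indep.
move=> [N' [mN' PN' NN']].
apply/eqP; rewrite eq_le measure_ge0 andbT -PN'.
rewrite /distribution /pushforward /=; apply: le_measure; rewrite ?inE//.
  by rewrite -[X in measurable X]setTI; exact: measurable_funPT.
move=> w /= /eqP Nw; apply: NN' => /=; apply/not_implyP; split=> // eqw.
by apply: Nw; rewrite -eqw.
Qed.

End conditional_law_of_independent.

Section kernel_probability.
Context {R : realType} {d1 d2 : measure_display}.
Context {E1 : measurableType d1} {E2 : measurableType d2}.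

Definition kernel_probability (kappa : R.-pker E1 ~> E2) (x : E1) : set E2 -> \bar R :=
  kappa x.

HB.instance Definition _ kappa x :=
  Measure.copy (kernel_probability kappa x) (kappa x).

HB.instance Definition _ kappa x := Measure_isProbability.Build _ _ _
  (kernel_probability kappa x) (prob_kernel x).

End kernel_probability.

(** * Trees over a finite family of splits *)

Section grid_trees.
Variable I : finType.

(** Unlike [tree], a grid tree takes its splits in a fixed finite family and
    carries the predicted labels at its leaves. *)
Inductive grid_tree : Type :=
| GLeaf (b : bool)
| GNode (i : I) (l r : grid_tree).

Fixpoint grid_leaves (t : grid_tree) : nat :=
  match t with GLeaf _ => 1%N | GNode _ l r => (grid_leaves l + grid_leaves r)%N end.

Lemma grid_leaves_gt0 t : (0 < grid_leaves t)%N.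
Proof. by elim: t => //= i l hl r hr; rewrite addn_gt0 hl. Qed.

(** Finite types whose elements code the grid trees of depth at most k, so that
    big operators can range over these trees. *)
Fixpoint depth_code (k : nat) : finType :=
  if k is k'.+1 then (bool + I * depth_code k' * depth_code k')%type else bool.

Fixpoint decode (k : nat) : depth_code k -> grid_tree :=
  match k return depth_code k -> grid_tree with
  | 0%N => fun b => GLeaf b
  | k'.+1 => fun c => match c with
    | inl b => GLeaf b
    | inr (i, l, r) => GNode i (decode l) (decode r)
    end
  end.

(** A binary tree with at most k + 1 leaves has depth at most k. *)
Lemma decode_surj t k : (grid_leaves t <= k.+1)%N -> exists c : depth_code k, decode c = t.
Proof.
elim: t k => [b|i l IHl r IHr] [|k] /=.
- by exists b.
- by exists (inl b).
- by rewrite leqNgt (leq_add (grid_leaves_gt0 l) (grid_leaves_gt0 r)).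
- move=> lr; have l0 := grid_leaves_gt0 l; have r0 := grid_leaves_gt0 r.
  have [|cl <-] := IHl k.
    by rewrite -ltnS (leq_trans _ lr)// -[ltnLHS]addn0 ltn_add2l.
  have [|cr <-] := IHr k.
    by rewrite -ltnS (leq_trans _ lr)// -[ltnLHS]add0n ltn_add2r.
  by exists (inr (i, cl, cr)).
Qed.

(** The sums G_k satisfy G_0 = 2a and G_(k+1) = 2a + #|I| G_k^2, and the interval
    [0, 4a] is stable under this recursion as soon as 8 #|I| a <= 1. *)
Lemma kraft_grid_trees (R : realType) (a : R) k : 0 <= a -> 8 * #|I|%:R * a <= 1 ->
  \sum_(c : depth_code k) a ^+ grid_leaves (decode c) <= 4 * a.
Proof.
move=> a0 am; elim: k => [|k IH] /=.
  by rewrite big_bool /= expr1; lra.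
rewrite big_sumType /= big_bool /= expr1.
set G := \sum_(c : depth_code k) _ in IH.
rewrite (eq_bigr (fun c : I * depth_code k * depth_code k =>
   a ^+ grid_leaves (decode c.1.2) * a ^+ grid_leaves (decode c.2))); last first.
  by move=> [[i l] r] _ /=; rewrite exprD.
rewrite -(pair_big xpredT xpredT (fun (x : I * depth_code k) y =>
  a ^+ grid_leaves (decode x.2) * a ^+ grid_leaves (decode y)))/=.
under eq_bigr => x _ do rewrite -mulr_sumr -/G.
rewrite -mulr_suml -(pair_big xpredT xpredT (fun (x : I) y =>
  a ^+ grid_leaves (decode y)))/= -/G sumr_const -[G *+ _]mulr_natl.
have G0 : 0 <= G by apply: sumr_ge0 => c _; rewrite exprn_ge0.
have m0 : 0 <= #|I|%:R :> R by [].
have GG : G * G <= (4 * a) * (4 * a) by apply: ler_pM.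
have := ler_wpM2l m0 GG; have := ler_wpM2l a0 am; rewrite -mulrA; lra.
Qed.

Section evaluation.
Context {d : measure_display} {T : measurableType d}.
Variables A S : I -> set T.
Hypotheses (mA : forall i, measurable (A i)) (mS : forall i, measurable (S i)).

Fixpoint grid_eval (t : grid_tree) (x : T) : bool :=
  match t with
  | GLeaf b => b
  | GNode i l r => if `[< A i x >] then grid_eval l x else grid_eval r x
  end.

(** Replacing a split by its grid version changes the branch taken by x only when
    x lies in the strip of that split; this set collects the strips of all the
    nodes. *)
Fixpoint grid_strip (t : grid_tree) : set T :=
  match t with
  | GLeaf _ => set0
  | GNode i l r => S i `|` (grid_strip l `|` grid_strip r)
  end.

Lemma measurable_grid_eval t : measurable_fun setT (grid_eval t).
Proof.
elim: t => [b|i l ml r mr] /=; first exact: measurable_cst.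
apply: (measurable_fun_bool true); rewrite setTI.
rewrite (_ : _ @^-1` _ = (A i `&` [set x | grid_eval l x = true]) `|`
                         (~` A i `&` [set x | grid_eval r x = true])).
  apply: measurableU; apply: measurableI => //; try exact: measurable_bool_fiber.
  exact: measurableC.
by apply/seteqP; split=> x /=; case: asboolP => Ax //; [left|right|case=> [[]|[]]|case=> [[]|[]]].
Qed.

Lemma measurable_grid_strip t : measurable (grid_strip t).
Proof. by elim: t => [b|i l ml r mr] //=; apply: measurableU => //; exact: measurableU. Qed.

(** A binary tree with D leaves has D - 1 nodes. *)
Lemma grid_strip_prob (R : realType) (Q : probability T R) (e : R) t :
  (forall i, fine (Q (S i)) <= e) ->
  fine (Q (grid_strip t)) <= ((grid_leaves t)%:R - 1) * e.
Proof.
move=> Se; elim: t => [b|i l hl r hr] /=; first by rewrite measure0 subrr mul0r.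
have ml := measurable_grid_strip l; have mr := measurable_grid_strip r.
apply: le_trans (fine_prob_leU Q _ (mS i) (measurableU _ _ ml mr) (@subset_refl _ _)) _.
  by apply: measurableU => //; exact: measurableU.
have := fine_prob_leU Q (measurableU _ _ ml mr) ml mr (@subset_refl _ _).
have := Se i; rewrite natrD; lra.
Qed.

End evaluation.

(** Outside the strips, x follows the same branches in T and in its grid version,
    hence ends in the same leaf; the label there is the constant value of u. *)
Lemma grid_approximation (R : realType) (p : nat) (A S : I -> set (p.-tuple R))
    (T : tree R p) (C : set (p.-tuple R)) (u : p.-tuple R -> bool) :
  (forall (j : 'I_p) (c : R), exists i, A i `<=` [set x | tnth x j <= c] /\
     [set x | tnth x j <= c] `<=` A i `|` S i) ->
  (forall B, leaf_cells T C B -> forall x y, B x -> B y -> u x = u y) ->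
  exists t, grid_leaves t = leaves T /\
    forall x, C x -> ~ grid_strip S t x -> u x = grid_eval A t x.
Proof.
move=> grid; elim: T C => [|j c l IHl r IHr] C /= uC.
  have [[x0 Cx0]|C0] := pselect (exists x, C x).
    by exists (GLeaf (u x0)); split=> // x Cx _; exact: (uC C).
  by exists (GLeaf true); split=> // x Cx; exfalso; apply: C0; exists x.
have [tl [Ll El]] := IHl _ (fun B h => uC B (or_introl h)).
have [tr [Lr Er]] := IHr _ (fun B h => uC B (or_intror h)).
have [i [Ai cAS]] := grid j c.
exists (GNode i tl tr); split; first by rewrite /= Ll Lr.
move=> x Cx /= /not_orP[nS /not_orP[nl nr]].
case: asboolP => [Ax|nAx].
  by apply: El => //; split=> //; exact: Ai.
apply: Er => //; split=> //=; rewrite ltNge; apply/negP => xc.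
by case: (cAS x xc).
Qed.

End grid_trees.

Lemma measurable_tree_function (R : realType) (p : nat) (T : tree R p) (u : p.-tuple R -> bool) :
  model T u -> measurable_fun setT u.
Proof.
move=> uT; apply: (measurable_fun_bool true).
suff H (C : set (p.-tuple R)) : measurable C ->
    (forall B, leaf_cells T C B -> forall x y, B x -> B y -> u x = u y) ->
    measurable (C `&` u @^-1` [set true]) by exact: H.
elim: T {uT} C => [|j c l IHl r IHr] C mC /= uC.
  have [[x0 [Cx0 ux0]]|C0] := pselect (exists x, C x /\ u x = true).
    rewrite (_ : _ `&` _ = C)//; apply/seteqP; split=> [x []//|x Cx].
    by split=> //=; rewrite (uC C erefl x x0).
  rewrite (_ : _ `&` _ = set0)// -subset0 => x [Cx ux]; apply: C0; exists x.
  by [].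
have mj : measurable [set x : p.-tuple R | tnth x j <= c].
  exact: (measurable_bool_fiber true (measurable_fun_ler (measurable_tnth j) (measurable_cst c))).
have mj' : measurable [set x : p.-tuple R | (c < tnth x j)%R].
  exact: (measurable_bool_fiber true (measurable_fun_ltr (measurable_cst c) (measurable_tnth j))).
rewrite (_ : C `&` _ = (C `&` [set x | tnth x j <= c] `&` u @^-1` [set true]) `|`
                       (C `&` [set x | (c < tnth x j)%R] `&` u @^-1` [set true])).
  apply: measurableU.
    by apply: IHl => [|B h]; [exact: measurableI|exact: uC (or_introl h)].
  by apply: IHr => [|B h]; [exact: measurableI|exact: uC (or_intror h)].
rewrite -setIUl -setIUr (_ : [set x | _] `|` _ = setT) ?setIT//.
by apply/seteqP; split=> x //= _; case: (leP (tnth x j) c); [left|right].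
Qed.

(** * Deviations for one classifier *)

Section classifier_deviation.
Context {R : realType} {d dT : measure_display} {Omega : measurableType d}.
Context {T : measurableType dT}.
Variables (P : probability Omega R) (Q : probability (T * bool)%type R).
Variables (n : nat) (Z : 'I_n -> Omega -> T * bool).
Hypothesis mZ : forall i, measurable_fun setT (Z i).
Hypothesis iidZ : forall B : 'I_n -> set (T * bool), (forall i, measurable (B i)) ->
  P [set w | forall i, B i (Z i w)] = (\prod_i Q (B i))%E.

Definition error_set (u : T -> bool) : set (T * bool) := [set z | u z.1 != z.2].

Definition error_count (u : T -> bool) (w : Omega) : R :=
  \sum_i (u (Z i w).1 != (Z i w).2)%:R.

Lemma measurable_error_set u : measurable_fun setT u -> measurable (error_set u).
Proof.
move=> mu; apply: (@measurable_neqb _ _ (u \o fst) snd) => //.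
by apply: measurableT_comp.
Qed.

Lemma measurable_feature_set (W : set T) : measurable W ->
  measurable [set z : T * bool | W z.1].
Proof.
move=> mW; have mfst : measurable_fun setT (@fst T bool) by [].
by rewrite -[X in measurable X]setTI; exact: (mfst measurableT _ mW).
Qed.

Lemma measurable_sum_gt (g : T * bool -> R) t : measurable_fun setT g ->
  measurable [set w | (t < \sum_i g (Z i w))%R].
Proof.
move=> mg.
have mS : measurable_fun setT (fun w => \sum_i g (Z i w)).
  by apply: measurable_sum => i; exact: measurableT_comp.
exact: (measurable_bool_fiber true (measurable_fun_ltr (measurable_cst t) mS)).
Qed.

(** Three applications of [ternary_chernoff]: to f and to - f with lam = h / 4,
    where f is the difference of the error indicators of v and s, and to the
    indicator of W with lam = 1. By hypothesis the second moment of f is at most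
    l / h, so the second moment term 2 (h / 4) (l / h) is half of the mean l. *)
Lemma classifier_deviation (s v : T -> bool) (W : set T) (h x : R) :
  measurable_fun setT s -> measurable_fun setT v -> measurable W ->
  0 < h <= 1 ->
  let l := fine (Q (error_set v)) - fine (Q (error_set s)) in
  h * fine (Q [set z : T * bool | v z.1 != s z.1]) <= l ->
  exists B : set Omega, [/\ measurable B, (P B <= (3 * expR (- x))%:E)%E &
    forall w, ~ B w ->
      [/\ error_count v w - error_count s w <= n%:R * (3 / 2 * l) + 4 * x / h,
          n%:R * (l / 2) <= error_count v w - error_count s w + 4 * x / h &
          \sum_i \1_W (Z i w).1 <= n%:R * (3 * fine (Q [set z : T * bool | W z.1])) + x]].
Proof.
move=> ms mv mW /andP[h0 h1] l hl.
have me u : measurable_fun setT u ->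
    measurable_fun setT (fun z : T * bool => (u z.1 != z.2)%:R : R).
  move=> mu; rewrite (_ : (fun z => _) = \1_(error_set u)).
    by apply: measurable_indic; exact: measurable_error_set.
  by apply/funext => z; rewrite indicE; congr (nat_of_bool _)%:R; apply/idP/idP; rewrite inE.
pose f (z : T * bool) : R := (v z.1 != z.2)%:R - (s z.1 != z.2)%:R.
have mf : measurable_fun setT f by apply: measurable_funB; exact: me.
pose g (z : T * bool) : R := - f z.
have mg : measurable_fun setT g by exact: measurableT_comp.
pose k (z : T * bool) : R := \1_W z.1.
have mk : measurable_fun setT k.
  by apply: measurableT_comp => //; exact: measurable_indic.
have f3 z : [\/ f z = 0, f z = 1 | f z = -1].
  rewrite /f; case: (_ != _); case: (_ != _) => /=.
  - by apply: Or31; rewrite subrr.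
  - by apply: Or32; rewrite subr0.
  - by apply: Or33; rewrite sub0r.
  - by apply: Or31; rewrite subrr.
have g3 z : [\/ g z = 0, g z = 1 | g z = -1].
  rewrite /g; case: (f3 z) => ->; rewrite ?oppr0 ?opprK; [exact: Or31|exact: Or33|exact: Or32].
have k3 z : [\/ k z = 0, k z = 1 | k z = -1].
  by rewrite /k indicE; case: (_ \in _); [exact: Or32|exact: Or31].
have mEv := measurable_error_set mv; have mEs := measurable_error_set ms.
pose F1 := error_set v `&` ~` error_set s; pose FN := error_set s `&` ~` error_set v.
have mF1 : measurable F1 by apply: measurableI => //; exact: measurableC.
have mFN : measurable FN by apply: measurableI => //; exact: measurableC.
have f1E : f @^-1` [set 1] = F1.
  apply/seteqP; split=> z; rewrite /F1 /error_set /f /=; case: (_ != z.2); case: (_ != z.2) => //=;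
    first [by [] | by case | by case=> _ [] | by move=> _; split | by move=> ?; lra
          | by move=> ?; exfalso; lra].
have fNE : f @^-1` [set -1] = FN.
  apply/seteqP; split=> z; rewrite /FN /error_set /f /=; case: (_ != z.2); case: (_ != z.2) => //=;
    first [by [] | by case | by case=> _ [] | by move=> _; split | by move=> ?; lra
          | by move=> ?; exfalso; lra].
have g1E : g @^-1` [set 1] = FN.
  by rewrite -fNE; apply/seteqP; split=> z; rewrite /g /= => gz; lra.
have gNE : g @^-1` [set -1] = F1.
  by rewrite -f1E; apply/seteqP; split=> z; rewrite /g /= => gz; lra.
have k1E : k @^-1` [set 1] = [set z : T * bool | W z.1].
  apply/seteqP; split=> z; rewrite /k /= indicE.
    by have [/set_mem//|_ /=] := boolP (_ \in W) => kz; exfalso; lra.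
  by move=> Wz; rewrite mem_set.
have kNE : k @^-1` [set -1] = set0.
  rewrite -subset0 => z; rewrite /k /= indicE; case: (_ \in W) => /= kz; lra.
have lE : l = fine (Q F1) - fine (Q FN).
  rewrite /l (fine_prob_cases Q mEv mEs) (fine_prob_cases Q mEs mEv) -/F1 -/FN.
  by rewrite [error_set s `&` error_set v]setIC; lra.
have qdE : fine (Q [set z : T * bool | v z.1 != s z.1]) = fine (Q F1) + fine (Q FN).
  rewrite -fine_probU//.
    congr (fine (Q _)); apply/seteqP; split=> z; rewrite /F1 /FN /error_set /=;
    by case: (v z.1); case: (s z.1); case: (z.2) => //=; intuition.
  by rewrite -subset0 => z [[_ nsz] [sz _]]; exact: (nsz sz).
rewrite qdE in hl.
have sumf w : \sum_i f (Z i w) = error_count v w - error_count s w.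
  by rewrite /f sumrB.
have sumg w : \sum_i g (Z i w) = - (error_count v w - error_count s w).
  by rewrite -sumf -sumrN.
have lam : 0 < h / 4 <= 1 by lra.
have one : 0 < (1 : R) <= 1 by rewrite ltr01 lexx.
have cf := ternary_chernoff (lam := h / 4) x mf f3 mZ iidZ lam.
have cg := ternary_chernoff (lam := h / 4) x mg g3 mZ iidZ lam.
have ck := ternary_chernoff (lam := 1) x mk k3 mZ iidZ one.
rewrite f1E fNE -lE in cf; rewrite g1E gNE in cg; rewrite k1E kNE measure0 /= in ck.
set tf := (_ + _) in cf; set tg := (_ + _) in cg; set tk := (_ + _) in ck.
have mBf := measurable_sum_gt tf mf.
have mBg := measurable_sum_gt tg mg.
have mBk := measurable_sum_gt tk mk.
exists ([set w | (tf < \sum_i f (Z i w))%R] `|` [set w | (tg < \sum_i g (Z i w))%R]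
        `|` [set w | (tk < \sum_i k (Z i w))%R]); split.
- by apply: measurableU => //; exact: measurableU.
- apply: (le_trans (measureU2 P (measurableU _ _ mBf mBg) mBk)).
  rewrite (_ : 3 * expR (- x) = expR (- x) + expR (- x) + expR (- x)); last by lra.
  rewrite !EFinD; apply: leeD => //.
  by apply: (le_trans (measureU2 P mBf mBg)); exact: leeD.
move=> w /not_orP[/not_orP[/negP + /negP +] /negP].
rewrite -!leNgt sumf sumg => hf hg hk.
have n0 : 0 <= n%:R :> R by [].
have h40 : x / (h / 4) = 4 * x / h by field; lra.
have := ler_wpM2l n0 hl => nhl.
split.
- by apply: le_trans hf _; rewrite /tf h40; nra.
- by move: hg; rewrite /tg h40; nra.
- by apply: le_trans hk _; rewrite /tk; nra.
Qed.

End classifier_deviation.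

(** * Consequences of mutual independence *)

Section independence.
Context {R : realType} {d dE : measure_display} {Omega : measurableType d}.
Context {E : measurableType dE} {P : probability Omega R}.

Lemma mutually_independent_family (I J : finType) (Z : I -> Omega -> E) (f : J -> I)
    (B : J -> set E) :
  mutually_independent P Z -> injective f -> (forall j, measurable (B j)) ->
  P [set w | forall j, B j (Z (f j) w)] = (\prod_j P (Z (f j) @^-1` B j))%E.
Proof.
move=> indep injf mB.
(* Outside the image of f the constraint is the full space. *)
pose B' i : set E := if [pick j | f j == i] is Some j then B j else setT.
have B'f j : B' (f j) = B j.
  by rewrite /B'; case: pickP => [j' /eqP/injf ->//|/(_ j)]; rewrite eqxx.
have mB' i : measurable (B' i) by rewrite /B'; case: pickP.
have := indep (f @: finset.setT)%SET B' mB'.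
rewrite big_imset/=; last by move=> ? ? _ _; exact: injf.
rewrite (_ : [set w | _] = [set w | forall j, B j (Z (f j) w)]); last first.
  apply/seteqP; split=> w /=.
    by move=> h j; rewrite -B'f; apply: h; apply: imset_f; rewrite finset.in_setT.
  by move=> h i /imsetP[j _ ->]; rewrite B'f.
move=> ->; apply: eq_big => [j|j _]; first by rewrite finset.in_setT.
by rewrite B'f.
Qed.

(** The index i0 is adjoined to the family f as an additional first index. *)
Lemma mutually_independent_split (I : finType) n (Z : I -> Omega -> E) (f : 'I_n -> I)
    (i0 : I) (B : 'I_n -> set E) (C : set E) :
  mutually_independent P Z -> injective f -> (forall j, f j != i0) ->
  (forall j, measurable (B j)) -> measurable C ->
  P ([set w | forall j, B j (Z (f j) w)] `&` Z i0 @^-1` C) =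
  (P [set w | forall j, B j (Z (f j) w)] * P (Z i0 @^-1` C))%E.
Proof.
move=> indep injf fi0 mB mC.
pose g (k : 'I_n.+1) := oapp f i0 (unlift ord0 k).
have gl j : g (lift ord0 j) = f j by rewrite /g liftK.
have g0 : g ord0 = i0 by rewrite /g unlift_none.
have injg : injective g.
  move=> a b; case: (unliftP ord0 a) => [j|] ->; case: (unliftP ord0 b) => [j'|] ->;
    rewrite ?gl ?g0 //.
  - by move=> /injf ->.
  - by move=> fj; have := fi0 j; rewrite fj eqxx.
  - by move=> fj; have := fi0 j'; rewrite fj eqxx.
pose BC (k : 'I_n.+1) := oapp B C (unlift ord0 k).
have BCl j : BC (lift ord0 j) = B j by rewrite /BC liftK.
have BC0 : BC ord0 = C by rewrite /BC unlift_none.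
have mBC k : measurable (BC k) by rewrite /BC; case: unlift.
have := mutually_independent_family indep injg mBC.
rewrite (_ : [set w | _] = [set w | forall j, B j (Z (f j) w)] `&` Z i0 @^-1` C); last first.
  apply/seteqP; split=> w /=.
    move=> allk; split; last by have := allk ord0; rewrite BC0 g0.
    by move=> j; have := allk (lift ord0 j); rewrite BCl gl.
  by move=> [hB hC] k; case: (unliftP ord0 k) => [j|] ->; rewrite ?BCl ?gl ?BC0 ?g0.
move=> ->; rewrite (mutually_independent_family indep injf mB) muleC big_ord_recl.
rewrite BC0 g0; congr (_ * _)%E.
by apply: eq_bigr => j _; rewrite BCl gl.
Qed.

End independence.

(** * Comparison of the entropy of the grid with the penalty *)

Section complexity.
Context {R : realType}.

Lemma ln_le_sub1 (x : R) : 0 < x -> ln x <= x - 1.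
Proof. by move=> x0; have := @le_ln1Dx R (x - 1); rewrite [1 + _]addrC subrK; apply; lra. Qed.

(** The function d (1 + ln (n / d)) is nondecreasing on [1, n] and equals
    1 + ln n at d = 1. *)
Lemma entropy_ge (n d : R) : 1 <= d -> d <= n -> 1 + ln n <= d * (1 + ln (n / d)).
Proof.
move=> d1 dn; have d0 : 0 < d by lra.
have n0 : 0 < n by lra.
rewrite ln_div ?posrE//.
have lnd : ln d <= d - 1 by exact: ln_le_sub1.
have lnn : ln d <= ln n by rewrite ler_ln ?posrE.
have := ler_wpM2l (_ : 0 <= d - 1) lnn; rewrite subr_ge0 => /(_ d1); lra.
Qed.

Lemma ln2_le1 : ln 2 <= 1 :> R.
Proof. by have := @ln_le_sub1 2; lra. Qed.

(** The hypothesis on p reads ln (p + 1) <= 1 + ln n, so the left-hand side is at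
    most 5 + 2 ln n, while [entropy_ge] bounds the right-hand side below by
    8 + 4 ln n. *)
Lemma grid_entropy_le (n p d : nat) : (0 < p)%N -> (2 <= d <= n)%N ->
  0 <= 1 + ln (n%:R / p.+1%:R : R) ->
  ln (8 * (p * n.+1)%:R) <= 4 * (1 + d%:R * (1 + ln (n%:R / d%:R))) :> R.
Proof.
move=> p0 /andP[d2 dn] hp.
have n0 : (0 < n)%N by rewrite (leq_trans _ dn)// ltnW.
have n0' : 0 < n%:R :> R by rewrite ltr0n.
have p0' : 0 < p%:R :> R by rewrite ltr0n.
have lnn : 0 <= ln n%:R :> R by rewrite ln_ge0// ler1n.
have ent : 1 + ln n%:R <= d%:R * (1 + ln (n%:R / d%:R)) :> R.
  by apply: entropy_ge; rewrite ?ler1n ?ler_nat// ltnW.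
rewrite ln_div ?posrE ?ltr0n// in hp.
have lnp : ln p%:R <= ln p.+1%:R :> R by rewrite ler_ln ?posrE ?ltr0n// ler_nat.
have lnn1 : ln n.+1%:R <= 1 + ln n%:R :> R.
  apply: (@le_trans _ _ (ln (2 * n%:R))).
    rewrite ler_ln ?posrE ?mulr_gt0 ?ltr0n// -natrM ler_nat.
    by rewrite mul2n -addnn -addn1 leq_add2l.
  by rewrite lnM ?posrE// lerD2r ln2_le1.
have ln8 : ln 8 <= 3 :> R.
  have -> : 8 = 2 * (2 * 2) :> R by lra.
  rewrite !lnM ?posrE ?mulr_gt0//; have := ln2_le1; lra.
set b := _ * _ in ent *; rewrite natrM !lnM ?posrE ?mulr_gt0 ?ltr0n//; lra.
Qed.

Lemma grid_entropy_ge2 (m : nat) : (2 <= m)%N -> 2 <= ln (8 * m%:R) :> R.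
Proof.
move=> m2; have m2' : 2 <= m%:R :> R by rewrite ler_nat.
apply: (@le_trans _ _ (ln (4 * 4))); last first.
  have m0 : 0 < m%:R :> R by lra.
  by rewrite ler_ln ?posrE ?mulr_gt0//; lra.
rewrite lnM ?posrE//; suff : 1 <= ln 4 :> R by lra.
rewrite -[leLHS]expRK ler_ln ?posrE ?expR_gt0//.
have := @expR_le_quad R 1; rewrite expr1n; lra.
Qed.

End complexity.

(** * Uniform deviations and bracketing *)

Section grid_event.
Context {R : realType} {d dT : measure_display} {Omega : measurableType d}.
Context {T : measurableType dT}.
Variables (P : probability Omega R) (Q : probability (T * bool)%type R).
Variables (n : nat) (Z : 'I_n -> Omega -> T * bool).
Hypothesis mZ : forall i, measurable_fun setT (Z i).
Hypothesis iidZ : forall B : 'I_n -> set (T * bool), (forall i, measurable (B i)) ->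
  P [set w | forall i, B i (Z i w)] = (\prod_i Q (B i))%E.
Variables (s : T -> bool) (h : R).
Hypotheses (ms : measurable_fun setT s) (h01 : 0 < h <= 1).
Hypothesis margin : forall v, measurable_fun setT v ->
  h * fine (Q [set z : T * bool | v z.1 != s z.1]) <=
  fine (Q (error_set v)) - fine (Q (error_set s)).
Variables (I : finType) (A S : I -> set T).
Hypotheses (mA : forall i, measurable (A i)) (mS : forall i, measurable (S i)).
(** The exceptional set of each tree, later the event on which the conditional
    law differs from Q on the events attached to that tree. *)
Variable Null : grid_tree I -> set Omega.
Hypotheses (mNull : forall t, measurable (Null t)) (PNull : forall t, P (Null t) = 0%E).

Definition tree_weight (xi : R) (t : grid_tree I) : R :=
  (grid_leaves t)%:R * ln (8 * #|I|%:R) + xi.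

(** Union bound over the grid trees with at most n + 1 leaves: the failure
    probability 3 exp(- x) of a tree t is 3 a^D exp(- xi), and these sum to at
    most 12 a exp(- xi) by [kraft_grid_trees], with a <= 1/16. *)
Lemma grid_event (xi : R) : (2 <= #|I|)%N ->
  exists E : set Omega, [/\ measurable E, ((1 - expR (- xi))%:E <= P E)%E &
    forall w, E w -> forall t, (grid_leaves t <= n.+1)%N ->
      let v := grid_eval A t in
      let l := fine (Q (error_set v)) - fine (Q (error_set s)) in
      let x := tree_weight xi t in
      [/\ ~ Null t w,
          error_count Z v w - error_count Z s w <= n%:R * (3 / 2 * l) + 4 * x / h,
          n%:R * (l / 2) <= error_count Z v w - error_count Z s w + 4 * x / h &
          \sum_i \1_(grid_strip S t) (Z i w).1 <=
            n%:R * (3 * fine (Q [set z : T * bool | grid_strip S t z.1])) + x]].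
Proof.
move=> m2; set m := #|I| in m2.
have m2' : 2 <= m%:R :> R by rewrite ler_nat.
have m0 : 0 < 8 * m%:R :> R by lra.
pose a : R := (8 * m%:R)^-1.
have a0 : 0 < a by rewrite invr_gt0.
have a16 : a <= 16^-1 by rewrite lef_pV2 ?posrE//; lra.
have weightE t : expR (- tree_weight xi t) = a ^+ grid_leaves t * expR (- xi).
  rewrite /tree_weight opprD expRD; congr (_ * _).
  by rewrite expRN expRM_natl lnK ?posrE// exprVn.
have [B hB] := choice (fun t => classifier_deviation mZ iidZ (tree_weight xi t) ms
  (measurable_grid_eval mA t) (measurable_grid_strip mS t) h01
  (margin (measurable_grid_eval mA t))).
pose Bad (c : depth_code I n) := B (decode c) `|` Null (decode c).
have mB t : measurable (B t) by case: (hB t).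
have mBad c : measurable (Bad c) by exact: measurableU.
pose U := \bigcup_(c in [set: depth_code I n]) Bad c.
have mU : measurable U by apply: fin_bigcup_measurable.
have PU : (P U <= (expR (- xi))%:E)%E.
  apply: (@le_trans _ _ (\sum_(c : depth_code I n)
      3 * (a ^+ grid_leaves (decode c) * expR (- xi)))%:E).
    apply: (measure_finite_union_le (B := Bad)) => //.
      by move=> w [c _ Bc]; exists c.
    move=> c; rewrite -weightE; apply: (le_trans (measureU2 P (mB _) (mNull _))).
    have PN : (P (Null (decode c)) <= 0)%E by rewrite PNull.
    have [_ PB _] := hB (decode c).
    by have := leeD PB PN; rewrite adde0.
  rewrite lee_fin -mulr_sumr -mulr_suml mulrA ler_piMl ?expR_ge0//.
  have := @kraft_grid_trees I R a n (ltW a0); rewrite -/m /a mulfV ?gt_eqF// => /(_ (lexx _)).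
  rewrite -/a; lra.
exists (~` U); split.
- exact: measurableC.
- rewrite probability_setC//.
  by rewrite EFinB leeB.
move=> w nU t tn v l x.
have [c ct] := decode_surj tn.
have [nB nN] : ~ B t w /\ ~ Null t w.
  by apply/not_orP => BN; apply: nU; exists c => //; rewrite /Bad ct.
have [_ _ /(_ w nB)[G1 G2 G3]] := hB t.
by split.
Qed.

End grid_event.

Section bracketing.
Context {R : realType} {dT : measure_display} {T : measurableType dT}.

Lemma error_count_bracket (d : measure_display) (Omega : measurableType d) n
    (Z : 'I_n -> Omega -> T * bool) (u v : T -> bool) (W : set T) w :
  (forall x, ~ W x -> u x = v x) ->
  `|error_count Z u w - error_count Z v w : R| <= \sum_i \1_W (Z i w).1 :> R.
Proof.
move=> uv; rewrite /error_count -sumrB; apply: le_trans (ler_norm_sum _ _ _) _.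
apply: ler_sum => i _; rewrite indicE.
have [Wx|/negP nW] := boolP (_ \in W) => /=.
  by case: (_ != _); case: (_ != _) => /=; rewrite ?subrr ?subr0 ?sub0r ?normrN ?normr0 ?normr1.
by rewrite uv ?subrr ?normr0// => Wx; apply: nW; rewrite inE.
Qed.

Lemma error_prob_bracket (K : probability (T * bool)%type R) (u v : T -> bool) (W : set T) :
  measurable_fun setT u -> measurable_fun setT v -> measurable W ->
  (forall x, ~ W x -> u x = v x) ->
  `|fine (K (error_set u)) - fine (K (error_set v))| <= fine (K [set z : T * bool | W z.1]).
Proof.
move=> mu mv mW uv.
have mEu := measurable_error_set mu; have mEv := measurable_error_set mv.
have mWf := measurable_feature_set mW.
have sub (f g : T -> bool) : (forall x, ~ W x -> f x = g x) ->
    error_set f `<=` error_set g `|` [set z : T * bool | W z.1].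
  move=> fg z fz; have [Wz|nW] := pselect (W z.1); first by right.
  by left; rewrite /error_set /= -fg.
have h1 := fine_prob_leU K mEu mEv mWf (sub _ _ uv).
have h2 := fine_prob_leU K mEv mEu mWf (sub _ _ (fun x nW => esym (uv x nW))).
by rewrite ler_norml; apply/andP; split; lra.
Qed.

End bracketing.

(** Here lu and lt are the true excess risks of a classifier u and of its grid
    version, Gu and ft their empirical counterparts multiplied by n, qW and wW
    the probability and the number of visits of the strips between them, and L
    the cost of one leaf. The bounds on the grid version are transferred to u;
    terms of order D / n and x / n are absorbed in those of order 1 / (n h)
    because h <= 1 and L >= 2. *)
Lemma bracket_arithmetic (R : realType) (n h D L xi lu lt Gu ft wW qW : R) :
  0 < n -> 0 < h <= 1 -> 0 <= D -> 2 <= L -> 0 <= xi ->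
  let x := D * L + xi in
  `|lu - lt| <= qW -> qW <= D / n -> `|Gu - ft| <= wW ->
  ft <= n * (3 / 2 * lt) + 4 * x / h -> n * (lt / 2) <= ft + 4 * x / h ->
  wW <= n * (3 * qW) + x ->
  lu <= 2 * (Gu / n) + (14 * (D * L) + 10 * xi) / (n * h) /\
  Gu / n <= 3 / 2 * lu + (8 * (D * L) + 5 * xi) / (n * h).
Proof.
move=> n0 /andP[h0 h1] D0 L2 xi0 x + qD + Hf Hl Hw.
rewrite !ler_norml => /andP[lu1 lu2] /andP[G1 G2].
have DL : 2 * D <= D * L by rewrite mulrC ler_wpM2l.
have x0 : 0 <= x by rewrite /x addr_ge0// mulr_ge0//; lra.
have nq : n * qW <= D by rewrite mulrC -ler_pdivlMr.
have hx : x <= x / h by rewrite ler_pdivlMr// ler_piMr.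
have hD : D <= D / h by rewrite ler_pdivlMr// ler_piMr.
have x4 : 4 * x / h = 4 * (x / h) by rewrite mulrA.
rewrite x4 in Hf Hl.
have expand (b c : R) : (b * (D * L) + c * xi) / (n * h) = ((b * (D * L) + c * xi) / h) / n.
  by field; rewrite !gt_eqF.
rewrite !expand.
have split_n (y b c : R) : (y <= b * (Gu / n) + c / n) = (n * y <= b * Gu + c).
  by rewrite mulrA -mulrDl ler_pdivlMr// [y * n]mulrC.
have split_G (y c : R) : (Gu / n <= y + c / n) = (Gu <= n * y + c).
  by rewrite ler_pdivrMr// mulrDl divfK ?gt_eqF// [y * n]mulrC.
rewrite split_n split_G.
have e1 : (14 * (D * L) + 10 * xi) / h = 4 * (D * L / h) + 10 * (x / h).
  by rewrite /x; field; rewrite gt_eqF.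
have e2 : (8 * (D * L) + 5 * xi) / h = 3 * (D * L / h) + 5 * (x / h).
  by rewrite /x; field; rewrite gt_eqF.
have DLh : 2 * (D / h) <= D * L / h by rewrite mulrA ler_wpM2r// invr_ge0 ltW.
have nlu1 := ler_wpM2l (ltW n0) lu1; have nlu2 := ler_wpM2l (ltW n0) lu2.
rewrite e1 e2; split; lra.
Qed.

(** * From uniform deviations to the oracle inequality *)

Section penalty.
Context {R : realType} {p n : nat}.
Variables (alpha beta h : R).
Hypotheses (alpha64 : 64 < alpha) (beta3 : 3 < beta) (n0 : (0 < n)%N) (h01 : 0 < h <= 1).
Hypothesis entropy0 : forall M : {set 'I_p}, M != finset.set0 ->
  0 <= 1 + ln (n%:R / #|M|.+1%:R : R).
Variables (M : {set 'I_p}) (T : tree R p).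
Hypothesis M0 : M != finset.set0.

Let n0' : 0 < n%:R :> R. Proof. by rewrite ltr0n. Qed.
Let h0 : 0 < h. Proof. by case/andP: h01. Qed.
Let nh0 : 0 < n%:R * h. Proof. exact: mulr_gt0. Qed.
Let cardM0 : (0 < #|M|)%N. Proof. by rewrite card_gt0. Qed.

Let B : R := 1 + #|M|.+1%:R * (1 + ln (n%:R / #|M|.+1%:R)).
Let B1 : 1 <= B.
Proof. by rewrite /B lerDl mulr_ge0// entropy0. Qed.

Let tree_part : R := alpha * B * ((leaves T)%:R / (n%:R * h)).
Let variable_part : R := beta * (#|M|%:R / (n%:R * h)) * (1 + ln (p%:R / #|M|%:R)).

Let penE : pen alpha beta h n M T = tree_part + variable_part. Proof. by []. Qed.

Let tree_part_ge : 64 * B * (leaves T)%:R / (n%:R * h) <= tree_part.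
Proof.
rewrite -mulrA /tree_part ler_wpM2r ?divr_ge0 ?(ltW nh0)//.
by rewrite ler_wpM2r ?(le_trans _ B1)// ltW.
Qed.

Let ln_ratio_ge0 : 0 <= ln (p%:R / #|M|%:R) :> R.
Proof.
apply: ln_ge0; rewrite ler_pdivlMr ?ltr0n// mul1r ler_nat.
by rewrite -[leqRHS]card_ord max_card.
Qed.

Let variable_part_ge : 3 * #|M|%:R / (n%:R * h) <= variable_part.
Proof.
rewrite /variable_part -mulrA.
have k0 : 0 <= #|M|%:R / (n%:R * h) by rewrite divr_ge0 ?(ltW nh0).
apply: (@le_trans _ _ (beta * (#|M|%:R / (n%:R * h)))).
  by rewrite ler_wpM2r// ltW.
rewrite ler_peMr ?lerDl// mulr_ge0//; have := beta3; lra.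
Qed.

Let over_nh (x : R) : n%:R <= x -> 1 <= x / (n%:R * h).
Proof.
move=> nx; rewrite ler_pdivlMr// mul1r (le_trans _ nx)// ler_piMr//.
by case/andP: h01.
Qed.

Let tree_part_ge0 : 0 <= tree_part.
Proof.
apply: le_trans tree_part_ge; rewrite divr_ge0 ?(ltW nh0)// !mulr_ge0//.
by rewrite (le_trans _ B1).
Qed.

Let variable_part_ge0 : 0 <= variable_part.
Proof. by apply: le_trans variable_part_ge; rewrite divr_ge0 ?(ltW nh0)// mulr_ge0. Qed.

Lemma pen_ge0 : 0 <= pen alpha beta h n M T.
Proof. by rewrite penE addr_ge0. Qed.

(** With more than n leaves the first part of the penalty is at least 64, and with
    |M| >= n the second one is at least 3. Otherwise |M| + 1 lies between 2 and
    n, and the bracket of the penalty dominates the cost of one leaf by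
    [grid_entropy_le]. *)
Lemma small_pen : pen alpha beta h n M T < 3 ->
  (leaves T <= n)%N /\
  16 * ((leaves T)%:R * ln (8 * (p * n.+1)%:R)) / (n%:R * h) <= pen alpha beta h n M T.
Proof.
rewrite penE => small.
have Mp : (#|M| <= p)%N by rewrite -[leqRHS]card_ord max_card.
have p0 : (0 < p)%N by exact: leq_trans Mp.
have Tn : (leaves T <= n)%N.
  rewrite leqNgt; apply/negP => nT.
  have : n%:R <= B * (leaves T)%:R :> R.
    apply: (@le_trans _ _ (leaves T)%:R); first by rewrite ler_nat ltnW.
    by rewrite ler_peMl.
  move/over_nh => big; have := tree_part_ge; rewrite -!mulrA [B * _]mulrA.
  have := variable_part_ge0; lra.
have Mn : (#|M| < n)%N.
  rewrite ltnNge; apply/negP => nM.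
  have : 1 <= #|M|%:R / (n%:R * h) by apply: over_nh; rewrite ler_nat.
  have := variable_part_ge; have := tree_part_ge0; rewrite -mulrA; lra.
split => //.
have entp : 0 <= 1 + ln (n%:R / p.+1%:R : R).
  have := @entropy0 finset.setT; rewrite cardsT card_ord; apply.
  by rewrite -card_gt0 cardsT card_ord.
have LB : ln (8 * (p * n.+1)%:R) <= 4 * B :> R.
  by apply: grid_entropy_le => //; rewrite ltnS cardM0.
apply: le_trans (_ : _ <= tree_part) _; last by have := variable_part_ge0; lra.
apply: le_trans tree_part_ge.
rewrite ler_wpM2r ?invr_ge0 ?(ltW nh0)//.
have := ler_wpM2l (ler0n R (leaves T)) LB; lra.
Qed.

End penalty.

Lemma empirical_risk_bounds (R : realType) p n (L : sample R p n) (u : p.-tuple R -> bool) :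
  (0 < n)%N -> 0 <= empirical_risk L u <= 1.
Proof.
move=> n0; have n0' : 0 < n%:R :> R by rewrite ltr0n.
have term i : 0 <= ((label L i)%:R - (u (obs L i))%:R : R) ^+ 2 <= 1.
  by case: (label L i); case: (u _) => /=; rewrite ?subrr ?subr0 ?sub0r ?sqrrN
    ?expr1n ?expr0n /= ?lexx ?ler01.
apply/andP; split.
  by rewrite mulr_ge0 ?invr_ge0// sumr_ge0// => i _; case/andP: (term i).
rewrite ler_pdivrMl// mulr1.
apply: (@le_trans _ _ (\sum_(i < n) 1)); last by rewrite sumr_const card_ord.
by apply: ler_sum => i _; case/andP: (term i).
Qed.

Section oracle.
Context {R : realType} {p n : nat}.
Variables (alpha beta h xi : R).
Hypotheses (alpha64 : 64 < alpha) (beta3 : 3 < beta) (n0 : (0 < n)%N) (h01 : 0 < h <= 1).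
Hypothesis xi0 : 0 <= xi.
Hypothesis entropy0 : forall M : {set 'I_p}, M != finset.set0 ->
  0 <= 1 + ln (n%:R / #|M|.+1%:R : R).
Variables (L : sample R p n) (K : probability (p.-tuple R * bool)%type R) (s : p.-tuple R -> bool).
Variables (Tmax : {set 'I_p} -> tree R p)
  (shat : {set 'I_p} -> tree R p -> p.-tuple R -> bool) (sel : {set 'I_p} * tree R p).
Hypothesis ms : measurable_fun setT s.

Let complexity (T : tree R p) : R := (leaves T)%:R * ln (8 * (p * n.+1)%:R).

Hypothesis bracket : forall T u, (leaves T <= n)%N -> model T u ->
  excess_loss K s u <= 2 * (empirical_risk L u - empirical_risk L s) +
    (14 * complexity T + 10 * xi) / (n%:R * h) /\
  empirical_risk L u - empirical_risk L s <= 3 / 2 * excess_loss K s u +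
    (8 * complexity T + 5 * xi) / (n%:R * h).
Hypothesis minimizer : forall m, candidate Tmax m -> empirical_minimizer L m.2 (shat m.1 m.2).
Hypothesis selP : selected L (pen alpha beta h n) Tmax shat sel.

Let excess_loss_bounds T u : model T u -> -1 <= excess_loss K s u <= 1.
Proof.
move=> /measurable_tree_function mu.
have := fine_prob_le1 K (measurable_error_set mu).
have := fine_prob_le1 K (measurable_error_set ms).
have := fine_prob_ge0 K (error_set u); have := fine_prob_ge0 K (error_set s).
by rewrite /excess_loss -/(error_set u) -/(error_set s); lra.
Qed.

(** The risk of the selected model is bounded by its penalized empirical risk,
    which is at most that of (M, T), itself bounded by the risk of u. If the
    penalty of (M, T) is at least 2, the right-hand side is at least 3 (-1 + 2)
    and the left-hand side at most 1; if that of the selected pair is at least 3,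
    then, empirical risks being in [0, 1], the selection rule forces the penalty
    of (M, T) to be at least 2. *)
Lemma oracle_inequality_model m u : candidate Tmax m -> model m.2 u ->
  excess_loss K s (shat sel.1 sel.2) <=
  3 * (excess_loss K s u + pen alpha beta h n m.1 m.2) + 20 * xi / (n%:R * h).
Proof.
move=> cm mu; case: (selP) => csel /(_ _ cm) sel_le.
have [msel _] := minimizer csel; have [mm minm] := minimizer cm.
have nh0 : 0 < n%:R * h by case/andP: h01 => *; rewrite mulr_gt0// ltr0n.
have /andP[_ lsel1] := excess_loss_bounds msel.
have /andP[lu1 _] := excess_loss_bounds mu.
have xi_ge0 : 0 <= 20 * xi / (n%:R * h) by rewrite divr_ge0 ?(ltW nh0)// mulr_ge0.
have [pen2|pen2] := leP 2 (pen alpha beta h n m.1 m.2); first by lra.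
have /andP[es0 _] := empirical_risk_bounds L (shat sel.1 sel.2) n0.
have /andP[_ em1] := empirical_risk_bounds L (shat m.1 m.2) n0.
have pen3 : pen alpha beta h n sel.1 sel.2 < 3 by lra.
have pen3' : pen alpha beta h n m.1 m.2 < 3 by lra.
have pens0 := pen_ge0 alpha64 beta3 n0 h01 entropy0 sel.2 csel.1.
have [selT selC] := small_pen alpha64 beta3 n0 h01 entropy0 csel.1 pen3.
have [mT mC] := small_pen alpha64 beta3 n0 h01 entropy0 cm.1 pen3'.
have [low _] := bracket selT msel.
have [_ up] := bracket mT mu.
have := minm _ mu.
rewrite -/(complexity _) in selC; rewrite -/(complexity _) in mC.
set i := (n%:R * h)^-1 in low up selC mC *.
lra.
Qed.

Lemma oracle_inequality :
  excess_loss K s (shat sel.1 sel.2) <=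
  3 * inf [set model_loss K s m.2 + pen alpha beta h n m.1 m.2 | m in candidate Tmax] +
  20 / (n%:R * h) * (1 + xi).
Proof.
have nhi0 : 0 < (n%:R * h)^-1.
  by case/andP: h01 => *; rewrite invr_gt0 mulr_gt0// ltr0n.
set l := excess_loss K s (shat sel.1 sel.2); set i := (n%:R * h)^-1 in nhi0 *.
suff : (l - 20 * i * (1 + xi)) / 3 <=
    inf [set model_loss K s m.2 + pen alpha beta h n m.1 m.2 | m in candidate Tmax] by lra.
apply: lb_le_inf.
  by case: selP => csel _; eexists; exists sel.
move=> _ [m cm <-]; rewrite -lerBlDr; apply: lb_le_inf.
  by exists (excess_loss K s (fun=> true)); exists (fun=> true).
move=> _ [u mu <-]; have := oracle_inequality_model cm mu.
rewrite -/l -/i; lra.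
Qed.

End oracle.

(** * The oracle inequality for the selected tree *)

Lemma empirical_riskE (R : realType) (d : measure_display) (Omega : measurableType d) p n
    (Z : 'I_n -> Omega -> p.-tuple R * bool) (L : sample R p n) (u : p.-tuple R -> bool) w :
  (forall i, tnth L i = Z i w) ->
  empirical_risk L u = error_count Z u w / n%:R.
Proof.
move=> LZ; rewrite /empirical_risk mulrC /error_count; congr (_ / _).
apply: eq_bigr => i _; rewrite /label /obs LZ.
by case: (Z i w).2; case: (u _) => /=; rewrite ?subrr ?subr0 ?sub0r ?sqrrN ?expr1n ?expr0n.
Qed.

Theorem proposition2 (R : realType) :
  exists alpha0 beta0 : R, 0 < alpha0 /\ 0 < beta0 /\
  forall alpha beta : R, alpha0 < alpha -> beta0 < beta ->
  exists C1 C2 Sigma : R, 2 < C1 /\ 0 < C2 /\ 0 < Sigma /\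
  forall (d : measure_display) (Omega : measurableType d)
    (P : probability Omega R) (p n1 n3 : nat)
    (X : {RV P >-> p.-tuple R}) (Y : {RV P >-> bool})
    (D : 'I_(n1 + n3) -> {RV P >-> (p.-tuple R * bool)%type})
    (eta : p.-tuple R -> R) (h : R)
    (kappa : R.-pker (n1.-tuple (p.-tuple R)) ~> (p.-tuple R * bool)%type)
    (phi : R -> R)
    (Tmax : sample R p n1 -> {set 'I_p} -> tree R p)
    (shat : sample R p n1 -> {set 'I_p} -> tree R p -> p.-tuple R -> bool)
    (sel : sample R p n1 -> {set 'I_p} * tree R p),
  let s := bayes eta in
  let L1 := subsample1 (fun i => D i : Omega -> _) in
  let l1 w := excess_loss (kappa (design (L1 w))) s in
  let l1S w := model_loss (kappa (design (L1 w))) s in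
  let stilde w := shat (L1 w) (sel (L1 w)).1 (sel (L1 w)).2 in
  (0 < n1)%N ->
  (forall M : {set 'I_p}, M != finset.set0 ->
     0 <= 1 + ln (n1%:R / #|M|.+1%:R : R)) ->
  regression_function X Y eta ->
  0 < h -> (forall x, h <= `|2 * eta x - 1|) ->
  independent_copies P (fun w => (X w, Y w)) (fun i => D i : Omega -> _) ->
  conditional_law P (fun w => (X w, Y w)) (fun w => design (L1 w)) kappa ->
  is_impurity phi ->
  (forall L M, M != finset.set0 -> maximal_tree phi L M (Tmax L M)) ->
  (forall L m, candidate (Tmax L) m ->
     empirical_minimizer L m.2 (shat L m.1 m.2)) ->
  (forall L, selected L (pen alpha beta h n1) (Tmax L) (shat L) (sel L)) ->
  forall xi : R, 0 < xi ->
  exists E : set Omega, measurable E /\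
    ((1 - expR (- xi) * Sigma ^+ 2)%:E <= P E)%E /\
    forall w, E w ->
      l1 w (stilde w) <=
        C1 * inf [set l1S w m.2 + pen alpha beta h n1 m.1 m.2
                 | m in candidate (Tmax (L1 w))]
        + C2 / (n1%:R * h) * (1 + xi).
Proof.
exists 64, 3; do 2 (split; first by []).
move=> alpha beta alpha64 beta3; exists 3, 20, 1.
split; first by lra.
do 2 (split; first by []).
move=> d Omega P p n1 n3 X Y D eta h kappa phi Tmax shat sel s L1 l1 l1S stilde.
move=> n0 entropy0 etaP h0 hmargin [indep same] condK _ _ minimizer selP xi xi0.
have h1 := margin_le1 etaP hmargin.
have h01 : 0 < h <= 1 by rewrite h0.
have ms : measurable_fun setT s := measurable_bayes etaP.
have p0 : (0 < p)%N.
  (* Any sample provides a selected pair, hence a nonempty set of variables. *)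
  pose L0 : sample R p n1 := [tuple ([tuple (0 : R) | _ < p], true) | _ < n1].
  have [[] + _ _] := selP L0; rewrite -card_gt0 => /leq_trans; apply.
  by rewrite -[leqRHS]card_ord max_card.
pose V : {RV P >-> (p.-tuple R * bool)%type} := pair_RV X Y.
pose Q : probability (p.-tuple R * bool)%type R := distribution P V.
pose Z (i : 'I_n1) (w : Omega) := D (lshift n3 i) w.
have mZ i : measurable_fun setT (Z i) by exact: measurable_funPT.
have injF : injective (fun i : 'I_n1 => Some (lshift n3 i)).
  by move=> i j [ij]; exact: val_inj.
have iidZ (B : 'I_n1 -> set (p.-tuple R * bool)) : (forall i, measurable (B i)) ->
    P [set w | forall i, B i (Z i w)] = (\prod_i Q (B i))%E.
  move=> mB; rewrite (mutually_independent_family indep injF mB).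
  by apply: eq_bigr => i _; exact: same.
have mU : measurable_fun setT (fun w => design (L1 w)).
  apply/measurable_fun_tnthP => i.
  rewrite (_ : _ \o _ = fst \o Z i); first exact: measurableT_comp.
  by apply/funext => w /=; rewrite tnth_mktuple /obs tnth_mktuple.
pose U : {mfun Omega >-> n1.-tuple (p.-tuple R)} :=
  HB.pack (fun w => design (L1 w)) (isMeasurableFun.Build _ _ _ _ _ mU).
have indepUV A B : measurable A -> measurable B ->
    P (U @^-1` A `&` V @^-1` B) = (P (U @^-1` A) * P (V @^-1` B))%E.
  move=> mA mB.
  have mVB : measurable (V @^-1` B).
    by rewrite -[X in measurable X]setTI; exact: measurable_funPT.
  rewrite -(fine_probK P mVB); apply: independent_of_rectangles => //.
    exact: fine_prob_ge0.
  move=> C mC; rewrite (fine_probK P mVB).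
  have := mutually_independent_split (i0 := None) indep injF (fun=> isT)
    (fun i => measurable_feature_set (mC i)) mB.
  rewrite (_ : [set w | forall i, C i (tnth (U w) i)] =
    [set w | forall i : 'I_n1, C i (Z i w).1])//.
  apply/seteqP; split=> w /= CZ i; have := CZ i;
    by rewrite tnth_mktuple /obs tnth_mktuple.
(* The conditional law agrees with Q on B outside the null set N B. *)
pose N B := [set w | kappa (U w) B != Q B].
have mPN B : measurable B -> measurable (N B) /\ P (N B) = 0%E.
  move=> mB; apply: (conditional_law_independent (V := V)) => // A mA.
  exact: indepUV.
have n0inv : 0 <= n1%:R^-1 :> R by rewrite invr_ge0.
have grid (j : 'I_p) := quantile_grid (distribution P X) (measurable_tnth j) n0.
have /choice[AS hAS] (j : 'I_p) : exists AS :
    ('I_n1.+1 -> set (p.-tuple R)) * ('I_n1.+1 -> set (p.-tuple R)),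
    [/\ forall k, measurable (AS.1 k), forall k, measurable (AS.2 k),
        forall k, fine (distribution P X (AS.2 k)) <= n1%:R^-1 &
        forall c, exists k, AS.1 k `<=` [set x | tnth x j <= c] /\
                            [set x | tnth x j <= c] `<=` AS.1 k `|` AS.2 k].
  by have [A [S AS]] := grid j; exists (A, S).
(* The family of splits: a coordinate and the index of one of its quantiles. *)
pose I : finType := ('I_p * 'I_n1.+1)%type.
pose A (i : I) := (AS i.1).1 i.2; pose S (i : I) := (AS i.1).2 i.2.
have mA i : measurable (A i) by case: (hAS i.1) => + _ _ _; apply.
have mS i : measurable (S i) by case: (hAS i.1) => _ + _ _; apply.
have QS i : fine (distribution P X (S i)) <= n1%:R^-1 by case: (hAS i.1) => _ _ + _; apply.
have gridI j c : exists i, A i `<=` [set x | tnth x j <= c] /\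
    [set x | tnth x j <= c] `<=` A i `|` S i.
  by case: (hAS j) => _ _ _ /(_ c)[k AkS]; exists (j, k).
have cardI : #|I| = (p * n1.+1)%N by rewrite card_prod !card_ord.
have I2 : (2 <= #|I|)%N.
  by rewrite cardI; apply: (@leq_mul 1 2).
have mev t := measurable_grid_eval mA t.
have mst t := measurable_grid_strip mS t.
pose Null t := N (error_set (grid_eval A t)) `|` N [set z | grid_strip S t z.1] `|` N (error_set s).
have mNe t := mPN _ (measurable_error_set (mev t)).
have mNs t := mPN _ (measurable_feature_set (mst t)).
have mN0 := mPN _ (measurable_error_set ms).
have nullU (B C : set Omega) : measurable B /\ P B = 0%E -> measurable C /\ P C = 0%E ->
    measurable (B `|` C) /\ P (B `|` C) = 0%E.
  by move=> [mB B0] [mC C0]; split; [exact: measurableU|rewrite measureU0].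
have nullN t := nullU _ _ (nullU _ _ (mNe t) (mNs t)) mN0.
have mNull t : measurable (Null t) := (nullN t).1.
have PNull t : P (Null t) = 0%E := (nullN t).2.
have [E [mE PE goodE]] := grid_event mZ iidZ ms h01
  (fun v mv => margin_le_excess_loss etaP hmargin mv) mA mS mNull PNull xi I2.
exists E; split => //; split; first by rewrite expr1n mulr1.
move=> w Ew.
pose K : probability (p.-tuple R * bool)%type R := kernel_probability kappa (U w).
have riskE u : empirical_risk (L1 w) u = error_count Z u w / n1%:R.
  by apply: empirical_riskE => i; rewrite tnth_mktuple.
apply: (oracle_inequality (K := K) alpha64 beta3 n0 h01 (ltW xi0) entropy0 ms
  _ (minimizer _) (selP _)).
move=> T u Tn uT.
have [t [tT ut]] := grid_approximation (C := setT) gridI uT.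
have uv x : ~ grid_strip S t x -> u x = grid_eval A t x by exact: ut.
have mu := measurable_tree_function uT.
have [] := goodE w Ew t; first by rewrite tT (leq_trans Tn).
move=> /not_orP[/not_orP[KQv KQW] KQs] up low strip.
have agree B : ~ N B w -> fine (K B) = fine (Q B) by move=> /negP/negPn/eqP KB; congr fine.
have qW : fine (Q [set z | grid_strip S t z.1]) <= (leaves T)%:R / n1%:R.
  have := grid_strip_prob mS t QS; rewrite tT; lra.
rewrite !riskE -mulrBl.
apply: (bracket_arithmetic (lt := fine (Q (error_set (grid_eval A t))) - fine (Q (error_set s)))
  (ft := error_count Z (grid_eval A t) w - error_count Z s w)
  (wW := \sum_i \1_(grid_strip S t) (Z i w).1)
  (qW := fine (Q [set z | grid_strip S t z.1]))) => //.
- by rewrite ltr0n.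
- by apply: grid_entropy_ge2; rewrite -cardI.
- exact: ltW.
- have := error_prob_bracket K mu (mev t) (mst t) uv.
  rewrite (agree _ KQv) (agree _ KQW) -(agree _ KQs) /excess_loss.
  by rewrite opprB addrA subrK.
- have := error_count_bracket Z w uv (R := R).
  by rewrite opprB addrA subrK.
- by move: up; rewrite /tree_weight tT cardI.
- by move: low; rewrite /tree_weight tT cardI.
- by move: strip; rewrite /tree_weight tT cardI.
Qed.
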